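(* Let $\Lambda_N$ be a sequence of finite subsets of $\mathbb{Z}^d$ increasing to $\mathbb{Z}^d$, and take a subsequence of $N$'s along which the limit of $\phi_{\Lambda_N, N,\beta}(s):=\langle W_{l_1}\cdots W_{l_n}\rangle_{\Lambda_N,N,\beta}/N^n$ exists for every loop sequence $s=(l_1,\ldots,l_n)$. Call this limit $\phi_\beta(s)$. Take any non-null loop sequence $s$ with minimal representation $(l_1,\ldots, l_n)$. Let $e$ be the first edge of $l_1$, let $A_1$ (resp. $B_1$) be the set of locations in $l_1$ where $e$ (resp. $e^{-1}$) occurs, $C_1=A_1\cup B_1$ and $m=|C_1|$. Then \begin{align*} m \phi_\beta(s) &= \textup{splitting term} + \textup{deformation term}\, , \end{align*} where the splitting term is \begin{align*} &\sum_{x\in A_1, \, y\in B_1} \phi_\beta(\times_{x,y}^1 l_1, \times_{x,y}^2 l_1,l_2,\ldots,l_n)+\sum_{x\in B_1, \, y\in A_1} \phi_\beta(\times_{x,y}^1 l_1, \times_{x,y}^2 l_1,l_2,\ldots,l_n) \\ &\qquad- \sum_{\substack{x,y\in A_1\\ x\ne y}} \phi_\beta(\times^1_{x,y} l_1,\times^2_{x,y} l_1,l_2,\ldots,l_n) - \sum_{\substack{x,y\in B_1\\ x\ne y}} \phi_\beta(\times^1_{x,y} l_1,\times^2_{x,y} l_1,l_2,\ldots,l_n)\, , \end{align*} and the deformation term is \begin{align*} &\beta \sum_{p\in \mathcal{P}^+(e)}\sum_{x\in C_1}\phi_\beta(l_1 \ominus_{x}p,l_2,\ldots,l_n) - \beta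 \sum_{p\in \mathcal{P}^+(e)}\sum_{x\in C_1}\phi_\beta(l_1 \oplus_{x}p,l_2,\ldots,l_n) \, . \end{align*}
   Context: Setting: the lattice $\mathbb{Z}^d$, $d\ge 2$, with directed nearest-neighbour edges; $e^{-1}$ is the reversed edge. Closed paths modulo cyclic rotation are cycles (with a ''first edge'' fixed by an arbitrary rule; locations counted from it); a backtrack is a consecutive pair $e\,e^{-1}$ (cyclically); $[l]$ is the nonbacktracking core obtained by repeatedly erasing backtracks. A loop is a nonbacktracking cycle; a plaquette is a nonbacktracking closed path of length 4; $\mathcal{P}^+(e)$ is the set of positively oriented plaquettes containing $e$ or $e^{-1}$. A loop sequence is a finite sequence of loops modulo insertion/deletion of null loops; the minimal representation has no null loops. Splitting of a loop $l$ at distinct locations $x,y$: if the same edge $e$ is at $x$ and $y$, write $l=aebec$ and set $\times^1_{x,y}l=[aec]$, $\times^2_{x,y}l=[be]$; if $e$ is at $x$ and $e^{-1}$ at $y$, write $l=aebe^{-1}c$ and set $\times^1_{x,y}l=[ac]$, $\times^2_{x,y}l=[b]$. Deformation: for a plaquette $p$ containing the edge at location $x$ of $l$ or its inverse, with $p$ having that edge $e$ (or $e^{-1}$) at its unique location: if $p$ carries $e$, writing $l=aeb$, $p=ced$, $l\oplus_x p=[aedceb]$ and $l\ominus_x p=[ac^{-1}d^{-1}b]$; if $p$ carries $e^{-1}$, writing $p=ce^{-1}d$, $l\oplus_x p=[aec^{-1}d^{-1}eb]$ and $l\ominus_x p=[adcb]$. $SO(N)$ lattice gauge theory on finite $\Lambda$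 at inverse coupling $\beta\in\mathbb{R}$: the probability measure proportional to $\exp(N\beta\sum_{p\in\mathcal{P}^+_\Lambda}\operatorname{Tr}(Q_p))\prod_{e\in E^+_\Lambda}d\sigma_N(Q_e)$ with Haar measure $\sigma_N$ on $SO(N)$, $Q_{e^{-1}}=Q_e^{-1}$; $\langle\cdot\rangle_{\Lambda,N,\beta}$ is its expectation; $W_l=\operatorname{Tr}(Q_{e_1}\cdots Q_{e_n})$ for $l=e_1\cdots e_n$ and $W_\emptyset=N$. Since $|W_l|\le N$, a subsequence as in the claim always exists by a diagonal argument. *)

(* Defs.v *)
From HB Require Import structures.
From mathcomp Require Import all_boot all_order all_algebra.
From mathcomp Require Import all_classical all_reals all_analysis.
Set Implicit Arguments. Unset Strict Implicit. Unset Printing Implicit Defensive.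
Import Order.TTheory GRing.Theory Num.Theory.
Import numFieldNormedType.Exports.
Local Open Scope ring_scope.

Definition vtx (d : nat) := {ffun 'I_d -> int}.

Definition basis (d : nat) (i : 'I_d) : vtx d := [ffun k => if k == i then 1 else 0].

(* directed nearest-neighbour edges: (x, i, b) is the edge x -> x + e_i
   if b = true, and the reversed edge x + e_i -> x if b = false. *)
Definition edge (d : nat) := (vtx d * 'I_d * bool)%type.

Definition esrc d (e : edge d) : vtx d :=
  let: (x, i, b) := e in if b then x else x + basis i.
Definition etgt d (e : edge d) : vtx d :=
  let: (x, i, b) := e in if b then x + basis i else x.
Definition einv d (e : edge d) : edge d :=
  let: (x, i, b) := e in (x, i, ~~ b).

Definition pinv d (c : seq (edge d)) : seq (edge d) := rev (map (@einv d) c).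

(* closed path (the empty list is the null loop) *)
Definition closed_path d (l : seq (edge d)) : bool :=
  cycle (fun a b => etgt a == esrc b) l.
Definition nonbacktracking d (l : seq (edge d)) : bool :=
  cycle (fun a b => b != einv a) l.
(* a loop: nonbacktracking closed path, represented by one of its rotations *)
Definition is_loop d (l : seq (edge d)) : bool := closed_path l && nonbacktracking l.

Fixpoint rm_bt d (l : seq (edge d)) : option (seq (edge d)) :=
  match l with
  | a :: ((b :: t) as t') => if b == einv a then Some t else omap (cons a) (rm_bt t')
  | _ => None
  end.
Definition bt_step d (l : seq (edge d)) : seq (edge d) :=
  match rm_bt l with
  | Some l' => l'
  | None => match l with
            | a :: t => if last a t == einv a then behead (belast a t) else l
            | [::] => l
            end
  end.
Definition core d (l : seq (edge d)) : seq (edge d) := iter (size l) (@bt_step d) l.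

(* splitting of l at locations x, y (0-based positions in the list l).
   Rotating so that location x comes first: rot x l = f :: r, the location y
   becomes position y' in rot x l. Returns (x^1_{x,y} l, x^2_{x,y} l). *)
Definition split_loop d (l : seq (edge d)) (x y : nat) : seq (edge d) * seq (edge d) :=
  match rot x l with
  | f :: r =>
      let y' := ((y + size l - x) %% size l)%N in
      let b := take y'.-1 r in
      let c := drop y' r in
      if nth f r y'.-1 == f then (core (f :: c), core (rcons b f))  (* l = a e b e c *)
      else (core c, core b)                                         (* l = a e b e^-1 c *)
  | [::] => ([::], [::])
  end.

Definition deform d (plus : bool) (l : seq (edge d)) (x : nat) (p : seq (edge d))
  : seq (edge d) :=
  match rot x l with
  | f :: r =>   (* l = a f b, rotated to f :: (b ++ a) *)
      if f \in p then
        let i := index f p in let c := take i p in let dd := drop i.+1 p in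
        if plus then core (f :: dd ++ c ++ f :: r)          (* [a e d c e b] *)
        else core (pinv c ++ pinv dd ++ r)                  (* [a c^-1 d^-1 b] *)
      else
        let i := index (einv f) p in let c := take i p in let dd := drop i.+1 p in
        if plus then core (f :: pinv c ++ pinv dd ++ f :: r) (* [a e c^-1 d^-1 e b] *)
        else core (dd ++ c ++ r)                             (* [a d c b] *)
  | [::] => [::]
  end.

(* the positively oriented plaquette x, x+e_a, x+e_a+e_b, x+e_b (a < b) *)
Definition plaq d (x : vtx d) (a b : 'I_d) : seq (edge d) :=
  [:: (x, a, true); (x + basis a, b, true); (x + basis b, a, false); (x, b, false)].

Definition dir_pairs d : seq ('I_d * 'I_d) :=
  [seq ab : 'I_d * 'I_d <- [seq (a, b) | a <- enum 'I_d, b <- enum 'I_d] | (nat_of_ord ab.1 < nat_of_ord ab.2)%N].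

(* P^+(e): positively oriented plaquettes containing e or e^{-1}.  Any such
   plaquette has base point x or x - e_j for some j, so we filter this finite
   family of candidates by the defining property. *)
Definition Pplus d (e : edge d) : seq (seq (edge d)) :=
  let: (x, _, _) := e in
  undup [seq p <- [seq plaq y ab.1 ab.2 | y <- x :: [seq x - basis j | j <- enum 'I_d],
                                          ab <- dir_pairs d]
        | (e \in p) || (einv e \in p)].

Definition SOset (R : realType) (N : nat) : set 'M[R]_N :=
  [set M | M^T *m M = 1%:M /\ \det M = 1].

(* I is the integral against the Haar probability measure sigma_N of SO(N):
   on continuous functions it is linear, positive (w.r.t. values on SO(N)),
   normalized and left-invariant; by the Riesz representation theorem and
   uniqueness of Haar measure this determines it on continuous functions. *)
Definition is_haar_integral (R : realType) (N : nat) (I : ('M[R]_N -> R) -> R) : Prop :=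
  [/\ (forall f g : 'M[R]_N -> R, continuous f -> continuous g ->
         I (fun M => f M + g M) = I f + I g),
      (forall (c : R) (f : 'M[R]_N -> R), continuous f -> I (fun M => c * f M) = c * I f),
      (forall f : 'M[R]_N -> R, continuous f -> (forall M, SOset M -> 0 <= f M) -> 0 <= I f),
      I (fun _ => 1) = 1 &
      (forall (g : 'M[R]_N) (f : 'M[R]_N -> R), SOset g -> continuous f ->
         I (fun M => f (g *m M)) = I f)].

(* positive edges (x, i) : x -> x + e_i, and gauge configurations *)
Definition posedge d := (vtx d * 'I_d)%type.
Definition config (R : realType) d N := posedge d -> 'M[R]_N.

(* Q_e, with Q_{e^{-1}} = Q_e^{-1} = Q_e^T on SO(N) *)
Definition emat (R : realType) d N (Q : config R d N) (e : edge d) : 'M[R]_N :=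
  let: (x, i, b) := e in if b then Q (x, i) else (Q (x, i))^T.

Definition wilson (R : realType) d N (Q : config R d N) (l : seq (edge d)) : R :=
  \tr (foldr (fun e M => emat Q e *m M) 1%:M l).

Definition Eplus d (L : seq (vtx d)) : seq (posedge d) :=
  [seq pe <- [seq (v, i) | v <- undup L, i <- enum 'I_d] | pe.1 + basis pe.2 \in L].

Definition PplusL d (L : seq (vtx d)) : seq (seq (edge d)) :=
  [seq plaq y.1 y.2.1 y.2.2 |
     y <- [seq y <- [seq (v, ab) | v <- undup L, ab <- dir_pairs d]
          | [&& y.1 + basis y.2.1 \in L, y.1 + basis y.2.2 \in L &
                y.1 + basis y.2.1 + basis y.2.2 \in L]]].

Definition upd (R : realType) d N (Q : config R d N) (pe : posedge d) (M : 'M[R]_N)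
  : config R d N := fun pe' => if pe' == pe then M else Q pe'.

Fixpoint prod_int (R : realType) d N (I : ('M[R]_N -> R) -> R) (es : seq (posedge d))
  (f : config R d N -> R) (Q : config R d N) : R :=
  match es with
  | [::] => f Q
  | pe :: es' => I (fun M => prod_int I es' f (upd Q pe M))
  end.

(* edges outside E^+_Lambda are frozen to the identity (irrelevant for the
   quantities considered once Lambda contains the loops). *)
Definition config0 (R : realType) d N : config R d N := fun _ => 1%:M.

Definition gibbs_weight (R : realType) d N (L : seq (vtx d)) (beta : R) (Q : config R d N) : R :=
  expR (N%:R * beta * \sum_(p <- PplusL L) wilson Q p).

Definition lgt_expect (R : realType) d N (I : ('M[R]_N -> R) -> R) (L : seq (vtx d))
  (beta : R) (F : config R d N -> R) : R :=
  prod_int I (Eplus L) (fun Q => F Q * gibbs_weight L beta Q) (@config0 R d N)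
  / prod_int I (Eplus L) (gibbs_weight L beta) (@config0 R d N).

Definition phiL (R : realType) d N (I : ('M[R]_N -> R) -> R) (L : seq (vtx d))
  (beta : R) (s : seq (seq (edge d))) : R :=
  lgt_expect I L beta (fun Q => \prod_(l <- s) wilson Q l) / N%:R ^+ size s.

(* Main.v *)
Require Import Defs.
From HB Require Import structures.
From mathcomp Require Import all_boot all_order all_algebra.
From mathcomp Require Import all_classical all_reals all_analysis.
From mathcomp Require Import ring lra zify.
Import Order.TTheory GRing.Theory Num.Theory.
Import numFieldNormedType.Exports.
Set Implicit Arguments. Unset Strict Implicit. Unset Printing Implicit Defensive.
Local Open Scope classical_set_scope.
Local Open Scope ring_scope.

(** A rotation in the plane of coordinates (a,b) acts on a single edge matrix by
left multiplication and preserves the Haar integral.  Differentiating at the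
identity gives, for X = E_ab - E_ba, that the expectation of the derivative in
direction X of Tr(X Q_w) W_(l_2) ... W_(l_n) exp(N beta sum_p W_p) vanishes, where
the closed word w is the loop l_1 cut open at a location x carrying e or its
inverse.  Summing over all (a,b), the identities
  sum Tr(XA) Tr(XB) = 2 Tr(A B^T) - 2 Tr(AB),
  sum Tr(XAXB) = 2 Tr(A B^T) - 2 Tr(A) Tr(B)
turn the derivative of Tr(X Q_w) at x itself into -2 (N-1) W_(l_1), at the other
locations of e and its inverse into splittings of l_1, and the derivative of the
weight into deformations of l_1; all other terms are traces of single orthogonal
matrices and disappear in the limit after division by N^(n+1).  The resulting
identity holds for each location x separately, and is summed over C_1.

Integrals are only available for continuous functions, so everything takes
place in a class of locally Lipschitz functions of the gauge configuration that is
stable under partial integration. *)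

(** * Closed paths and their cores *)

Section Paths.
Variable d : nat.
Implicit Types (a b f : edge d) (l u v w t : seq (edge d)) (x y z : vtx d).

Lemma einvK : involutive (@einv d).
Proof. by case=> [[x i] b] /=; rewrite negbK. Qed.

Lemma einv_eqF a : (einv a == a) = false.
Proof. by apply/negbTE/eqP; case: a => [[x i] []] []. Qed.

Lemma eq_einv_sym a b : (a == einv b) = (b == einv a).
Proof. by apply/eqP/eqP => ->; rewrite einvK. Qed.

Lemma esrc_einv a : esrc (einv a) = etgt a.
Proof. by case: a => [[x i] []]. Qed.

Lemma etgt_einv a : etgt (einv a) = esrc a.
Proof. by case: a => [[x i] []]. Qed.

(** [closed_path] compares cyclic neighbours, a condition that cutting a list disturbs. A path with
    named endpoints splits at any cut. *)
Fixpoint walk x l y : bool :=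
  if l is a :: l' then (esrc a == x) && walk (etgt a) l' y else x == y.

Lemma walk_cat x u v y :
  walk x (u ++ v) y <-> exists2 z, walk x u z & walk z v y.
Proof.
elim: u x => [|a u IH] x /=.
  by split=> [h|[z /eqP->]//]; exists x.
split=> [/andP[-> /IH[z h1 h2]]|[z /andP[-> h1] h2]]; first by exists z.
by apply/IH; exists z.
Qed.

Lemma closed_pathP l : closed_path l <-> exists x, walk x l x.
Proof.
case: l => [|a t]; first by split=> // _; exists 0 => /=.
have E : closed_path (a :: t) = walk (etgt a) t (esrc a).
  rewrite /closed_path /=; elim: t {1 3}a => [|b t IH] c /=; first by rewrite andbT.
  by rewrite IH eq_sym.
rewrite E; split=> [h|[x /= /andP[/eqP-> //]]].
by exists (esrc a); rewrite /= eqxx.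
Qed.

Lemma walk_pinv x l y : walk x l y -> walk y (Defs.pinv l) x.
Proof.
rewrite /Defs.pinv; elim: l x => [|a l IH] x /=; first by rewrite eq_sym.
case/andP=> /eqP<- /IH h; rewrite rev_cons -cats1.
by apply/walk_cat; exists (etgt a); rewrite //= esrc_einv etgt_einv !eqxx.
Qed.

Lemma closed_path_catC u v : closed_path (u ++ v) -> closed_path (v ++ u).
Proof.
case/closed_pathP=> x /walk_cat[z h1 h2]; apply/closed_pathP.
by exists z; apply/walk_cat; exists x.
Qed.

Lemma rm_btP l :
  if rm_bt l is Some l' then
    exists u a v, l = u ++ a :: einv a :: v /\ l' = u ++ v
  else sorted (fun a b => b != einv a) l.
Proof.
elim: l => [|a [|b t] IH] //.
rewrite [rm_bt _]/=; case: eqP => [->|ne]; first by exists [::], a, t.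
move: IH; rewrite -/(rm_bt (b :: t)); case: (rm_bt _) => [l' [u [c [v [-> ->]]]]|].
  by exists (a :: u), c, v.
by move=> /= ->; rewrite andbT; apply/eqP.
Qed.

Lemma bt_stepP l :
  [\/ nonbacktracking l /\ bt_step l = l,
      exists u a v, l = u ++ a :: einv a :: v /\ bt_step l = u ++ v |
      exists a t, l = a :: rcons t (einv a) /\ bt_step l = t].
Proof.
rewrite /bt_step; move: (rm_btP l); case: (rm_bt l) => [l' h|]; first by apply: Or32.
case: l => [|a t] /= h; first by apply: Or31.
case: eqP => [e|/eqP ne].
  apply: Or33; exists a; case/lastP: t h e => [|t b] h /=.
    by move/eqP; rewrite eq_sym einv_eqF.
  by rewrite last_rcons => ->; exists t; rewrite belast_rcons.
by apply: Or31; split=> //; rewrite /nonbacktracking /= rcons_path h eq_einv_sym.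
Qed.

(** Forming the core only deletes cancelling pairs, inside the list or across its two ends, so
    whatever survives both deletions passes to the core. This serves for closedness and for Wilson
    loops. *)
Lemma core_ind (P : seq (edge d) -> Prop) l :
  (forall u a v, P (u ++ a :: einv a :: v) -> P (u ++ v)) ->
  (forall a t, P (a :: rcons t (einv a)) -> P t) ->
  P l -> P (core l).
Proof.
move=> h1 h2; rewrite /core; elim: (size l) {-2}l => [//|n IH] {}l h.
rewrite iterSr; apply: IH.
by case: (bt_stepP l) h => [[_ ->//]|[u [a [v [-> ->]]]]|[a [t [-> ->]]]]; [apply: h1|apply: h2].
Qed.

(** A step that finds a pair shortens the list by two, and a list without a pair is nonbacktracking,
    so [size l] steps suffice. *)
Lemma core_nonbacktracking l : nonbacktracking (core l).
Proof.
suff h m l' : (size l' <= m)%N -> nonbacktracking (iter m (@bt_step d) l') by exact: h.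
elim: m l' => [|m IH] {}l; first by rewrite leqn0 size_eq0 => /eqP->.
move=> le; case: (bt_stepP l) => [[h e]|[u [a [v [e1 e2]]]]|[a [t [e1 e2]]]].
- by rewrite iter_fix.
- rewrite iterSr; apply: IH; rewrite e2; move: le.
  by rewrite e1 !size_cat /= !addnS ltnS => /ltnW.
- rewrite iterSr; apply: IH; rewrite e2; move: le.
  by rewrite e1 /= size_rcons ltnS => /ltnW.
Qed.

Lemma core_loop l : closed_path l -> is_loop (core l).
Proof.
move=> h; rewrite /is_loop core_nonbacktracking andbT.
apply: (@core_ind (fun l => closed_path l)) h => [u a v|a t] /closed_pathP[x].
  case/walk_cat=> z h1 /= /and3P[/eqP e _ ].
  by rewrite etgt_einv e => h2; apply/closed_pathP; exists x; apply/walk_cat; exists z.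
rewrite -cats1 /= => /andP[/eqP <-] /walk_cat[z h1] /=.
rewrite esrc_einv => /andP[/eqP e _]; apply/closed_pathP.
by exists (etgt a); rewrite {2}e.
Qed.

End Paths.

(** * Words in orthogonal matrices *)

Section Words.
Variables (R : realType) (N d : nat).
Implicit Types (Q : config R d N) (a b : edge d) (l u v w : seq (edge d)).
Implicit Types (M : 'M[R]_N).

Definition wmat Q l : 'M[R]_N := foldr (fun e M => emat Q e *m M) 1%:M l.

Definition SOconf Q := forall pe, SOset (Q pe).

Lemma wmat_cat Q u v : wmat Q (u ++ v) = wmat Q u *m wmat Q v.
Proof. by elim: u => [|a u /= ->]; rewrite ?mul1mx ?mulmxA. Qed.

Lemma wmat_rcons Q u a : wmat Q (rcons u a) = wmat Q u *m emat Q a.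
Proof. by rewrite -cats1 wmat_cat /= mulmx1. Qed.

Lemma emat_einv Q a : emat Q (einv a) = (emat Q a)^T.
Proof. by case: a => [[x i] []] //=; rewrite trmxK. Qed.

Lemma wmat_pinv Q l : wmat Q (Defs.pinv l) = (wmat Q l)^T.
Proof.
rewrite /Defs.pinv; elim: l => [|a l IH] /=; first by rewrite trmx1.
by rewrite rev_cons wmat_rcons IH emat_einv trmx_mul.
Qed.

Lemma wilson_catC Q u v : wilson Q (u ++ v) = wilson Q (v ++ u).
Proof. by rewrite /wilson -/(wmat Q _) -/(wmat Q _) !wmat_cat mxtrace_mulC. Qed.

Lemma wilson_nil Q : wilson Q [::] = N%:R.
Proof. by rewrite /wilson /= mxtrace1. Qed.

Lemma wilson_rot Q n l : wilson Q (rot n l) = wilson Q l.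
Proof. by rewrite /rot wilson_catC cat_take_drop. Qed.

Definition orth M := M^T *m M = 1%:M.

Lemma orthT M : orth M -> orth M^T.
Proof. by rewrite /orth trmxK => /mulmx1C. Qed.

Lemma orthM M M' : orth M -> orth M' -> orth (M *m M').
Proof. by rewrite /orth => h h'; rewrite trmx_mul mulmxA -(mulmxA M'^T) h mulmx1. Qed.

Lemma orth1 : orth 1%:M.
Proof. by rewrite /orth trmx1 mulmx1. Qed.

Lemma orth_emat Q a : SOconf Q -> orth (emat Q a).
Proof.
move=> h; case: a => [[x i] b] /=; case: (h (x, i)) => o _.
by case: b => //; apply: orthT.
Qed.

Lemma orth_wmat Q l : SOconf Q -> orth (wmat Q l).
Proof.
move=> h; elim: l => [|a l IH] /=; first exact: orth1.
by apply: orthM => //; apply: orth_emat.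
Qed.

(** The squares of the entries of a column sum to one. *)
Lemma orth_entry M i j : orth M -> `|M i j| <= 1.
Proof.
move=> /matrixP /(_ j j); rewrite !mxE eqxx mulr1n (bigD1 i) //= mxE => h.
rewrite -(@expr_le1 _ 2) // real_normK ?num_real // -{}h expr2 lerDl.
by apply: sumr_ge0 => k _; rewrite mxE -expr2 sqr_ge0.
Qed.

Lemma orth_trace M : orth M -> `|\tr M| <= N%:R.
Proof.
move=> h; apply: (le_trans (ler_norm_sum _ _ _)).
rewrite -[N in leRHS]card_ord -sumr_const.
by apply: ler_sum => i _; apply: orth_entry.
Qed.

Lemma wilson_bound Q l : SOconf Q -> `|wilson Q l| <= N%:R.
Proof. by move=> h; apply/orth_trace/orth_wmat. Qed.

Lemma emat_mul_einv Q a : SOconf Q -> emat Q a *m emat Q (einv a) = 1%:M.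
Proof. by move=> h; rewrite emat_einv; apply: mulmx1C; apply: orth_emat. Qed.

(** An inner backtrack multiplies to the identity; one across the ends does so after a cyclic shift
    under the trace. *)
Lemma wilson_core Q l : SOconf Q -> wilson Q (core l) = wilson Q l.
Proof.
move=> h.
apply: (@core_ind d (fun l' => wilson Q l' = wilson Q l)) => // [u a v|a t] <-;
  rewrite /wilson -!/(wmat Q _).
  by rewrite !wmat_cat /= (mulmxA (emat Q a)) emat_mul_einv // mul1mx.
rewrite /= -/(wmat Q _) wmat_rcons mxtrace_mulC -mulmxA.
by rewrite -{2}[a]einvK emat_mul_einv // mulmx1.
Qed.

End Words.

(** * Haar integrals of locally Lipschitz functions *)

Section LocallyLipschitz.
Variables (R : realType) (N d : nat).
Implicit Types (Q : config R d N) (f g : config R d N -> R) (pe : posedge d).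
Implicit Types (M : 'M[R]_N).

Definition cbnd (B : R) Q := forall pe i j, `|Q pe i j| <= B.
Definition cclose (eps : R) Q Q' := forall pe i j, `|Q pe i j - Q' pe i j| <= eps.
Definition cbounded Q := exists B : R, cbnd B Q.

(* Bounded and Lipschitz on bounded sets of configurations, for the supremum
   norm over all edges; this class is stable under the partial integrals
   without any appeal to the compactness of SO(N). *)
Definition loclip f := forall B : R, exists K : R, [/\ 0 <= K,
  forall Q, cbnd B Q -> `|f Q| <= K &
  forall Q Q' (eps : R), 0 <= eps -> cbnd B Q -> cbnd B Q' -> cclose eps Q Q' ->
    `|f Q - f Q'| <= K * eps].

Lemma eq_loclip f g : f =1 g -> loclip f -> loclip g.
Proof. by move=> /funext ->. Qed.

Lemma loclip_cst (c : R) : loclip (fun=> c).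
Proof.
move=> B; exists `|c|; split=> // Q Q' eps e0 _ _ _.
by rewrite subrr normr0 mulr_ge0.
Qed.

Lemma loclip_add f g : loclip f -> loclip g -> loclip (fun Q => f Q + g Q).
Proof.
move=> hf hg B; have [K [K0 b1 c1]] := hf B; have [L [L0 b2 c2]] := hg B.
exists (K + L); split=> [|Q hQ|Q Q' eps e0 h h' hc]; first exact: addr_ge0.
  by apply: (le_trans (ler_normD _ _)); rewrite lerD ?b1 ?b2.
rewrite /= opprD addrACA mulrDl; apply: (le_trans (ler_normD _ _)).
by rewrite lerD ?c1 ?c2.
Qed.

Lemma loclip_mul f g : loclip f -> loclip g -> loclip (fun Q => f Q * g Q).
Proof.
move=> hf hg B; have [K [K0 b1 c1]] := hf B; have [L [L0 b2 c2]] := hg B.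
exists (K * L + K * L); split=> [|Q hQ|Q Q' eps e0 h h' hc].
- by rewrite addr_ge0 ?mulr_ge0.
- rewrite /= normrM; apply: (le_trans (ler_pM _ _ (b1 _ hQ) (b2 _ hQ))) => //.
  by rewrite lerDl mulr_ge0.
- rewrite (_ : _ - _ = f Q * (g Q - g Q') + (f Q - f Q') * g Q'); last by ring.
  apply: (le_trans (ler_normD _ _)); rewrite !normrM [leRHS]mulrDl; apply: lerD.
    by rewrite -mulrA ler_pM ?b1 ?c2.
  by rewrite mulrAC ler_pM ?b2 ?c1.
Qed.

Lemma loclip_sum (I : Type) (r : seq I) (P : pred I) (F : I -> config R d N -> R) :
  (forall i, loclip (F i)) -> loclip (fun Q => \sum_(i <- r | P i) F i Q).
Proof.
move=> h; elim: r => [|i r IH].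
  by apply: eq_loclip (loclip_cst 0) => Q; rewrite big_nil.
case Pi : (P i).
  by apply: eq_loclip (loclip_add (h i) IH) => Q; rewrite big_cons Pi.
by apply: eq_loclip IH => Q; rewrite big_cons Pi.
Qed.

Lemma loclip_prod (I : Type) (r : seq I) (F : I -> config R d N -> R) :
  (forall i, loclip (F i)) -> loclip (fun Q => \prod_(i <- r) F i Q).
Proof.
move=> h; elim: r => [|i r IH].
  by apply: eq_loclip (loclip_cst 1) => Q; rewrite big_nil.
by apply: eq_loclip (loclip_mul (h i) IH) => Q; rewrite big_cons.
Qed.

(** For y <= x, factor out exp x and use 1 - exp (y - x) <= x - y. *)
Lemma expR_lip (x y K : R) : x <= K -> y <= K ->
  `|expR x - expR y| <= expR K * `|x - y|.
Proof.
wlog le : x y / y <= x => [H|xK _].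
  by case: (leP y x) => [|/ltW] le h1 h2; [|rewrite distrC (distrC x)]; apply: H.
rewrite !ger0_norm ?subr_ge0 ?ler_expR //.
have -> : expR y = expR x * expR (y - x) by rewrite -expRD addrC subrK.
rewrite -{1}(mulr1 (expR x)) -mulrBr ler_pM ?expR_ge0 ?ler_expR //.
  by rewrite subr_ge0 -expR0 ler_expR subr_le0.
by rewrite lerBlDr addrC -lerBlDr opprB; have := expR_ge1Dx (y - x); rewrite addrC.
Qed.

Lemma loclip_exp f : loclip f -> loclip (fun Q => expR (f Q)).
Proof.
move=> hf B; have [K [K0 b c]] := hf B.
(* In the factor [K + 1], the summand 1 serves the bound and [K] the Lipschitz estimate. *)
exists (expR K * (K + 1)); split=> [|Q hQ|Q Q' eps e0 h h' hc].
- by rewrite mulr_ge0 ?expR_ge0 ?addr_ge0.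
- rewrite /= ger0_norm ?expR_ge0 // -[leLHS]mulr1 ler_pM ?expR_ge0 //.
    by rewrite ler_expR (le_trans (ler_norm _)) // b.
  by rewrite lerDr.
- apply: le_trans (expR_lip (le_trans (ler_norm _) (b _ h)) (le_trans (ler_norm _) (b _ h'))) _.
  rewrite -mulrA ler_pM ?expR_ge0 // (le_trans (c _ _ _ e0 h h' hc)) //.
  by rewrite ler_wpM2r // lerDl.
Qed.

Lemma loclip_coord pe i j : loclip (fun Q => Q pe i j).
Proof.
move=> B; exists (Num.max B 1); split=> [|Q h|Q Q' eps e0 _ _ hc].
- by rewrite le_max ler01 orbT.
- by rewrite le_max h.
- by rewrite (le_trans (hc _ _ _)) // -{1}[eps]mul1r ler_wpM2r // le_max lexx orbT.
Qed.

Definition loclip_mx (F : config R d N -> 'M[R]_N) := forall i j, loclip (fun Q => F Q i j).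

Lemma loclip_mulmx F G : loclip_mx F -> loclip_mx G -> loclip_mx (fun Q => F Q *m G Q).
Proof.
move=> hF hG i j; apply: (eq_loclip (f := fun Q => \sum_k F Q i k * G Q k j)).
  by move=> Q; rewrite mxE.
by apply: loclip_sum => k; apply: loclip_mul.
Qed.


Lemma loclip_cstmx M : loclip_mx (fun=> M).
Proof. by move=> i j; apply: loclip_cst. Qed.

Lemma loclip_trmx F : loclip_mx F -> loclip_mx (fun Q => (F Q)^T).
Proof. by move=> hF i j; apply: eq_loclip (hF j i) => Q; rewrite mxE. Qed.

Lemma loclip_tr F : loclip_mx F -> loclip (fun Q => \tr (F Q)).
Proof. by move=> h; apply: loclip_sum. Qed.

Lemma loclip_emat (a : edge d) : loclip_mx (fun Q => emat Q a).
Proof.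
case: a => [[x i] []] /=; last apply: loclip_trmx; exact: loclip_coord.
Qed.

Lemma loclip_wmat (l : seq (edge d)) : loclip_mx (fun Q => wmat Q l).
Proof.
elim: l => [|a l IH] /=; first exact: loclip_cstmx.
by apply: loclip_mulmx => //; apply: loclip_emat.
Qed.

Lemma loclip_wilson (l : seq (edge d)) : loclip (fun Q => wilson Q l).
Proof. exact: loclip_tr (loclip_wmat l). Qed.

Lemma loclip_gibbs L beta : loclip (@gibbs_weight R d N L beta).
Proof.
apply: loclip_exp; apply: loclip_mul (loclip_cst _) _.
by apply: loclip_sum => p; apply: loclip_wilson.
Qed.

Lemma cbnd_upd (B B' : R) Q pe M : cbnd B Q -> (forall i j, `|M i j| <= B') ->
  cbnd (Num.max B B') (upd Q pe M).
Proof.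
by move=> hQ hM pe' i j; rewrite /upd le_max; case: eqP => _; rewrite ?hM ?hQ ?orbT.
Qed.

Lemma SOset_entry M i j : SOset M -> `|M i j| <= 1.
Proof. by case=> h _; apply: orth_entry. Qed.

Lemma SOconf_cbnd Q : SOconf Q -> cbnd 1 Q.
Proof. by move=> h pe i j; apply: SOset_entry. Qed.

Lemma SOconf_upd Q pe M : SOconf Q -> SOset M -> SOconf (upd Q pe M).
Proof. by move=> h hM pe'; rewrite /upd; case: eqP. Qed.

Lemma SOconf_config0 : SOconf (@config0 R d N).
Proof. by move=> pe; split; rewrite ?det1 // trmx1 mulmx1. Qed.

Lemma SOconf_bounded Q : SOconf Q -> cbounded Q.
Proof. by move=> /SOconf_cbnd h; exists 1. Qed.

Lemma mx_entry_norm M i j : `|M i j| <= `|M|.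
Proof.
rewrite [leRHS]/Num.norm /= mx_normrE.
by apply/bigmax_geP; right => /=; exists (i, j).
Qed.

Lemma cbounded_upd Q pe M : cbounded Q -> cbounded (upd Q pe M).
Proof.
case=> B h; exists (Num.max B `|M|); apply: cbnd_upd h _ => i j.
exact: mx_entry_norm.
Qed.

(** The Haar axioms speak of functions continuous on all matrices, so [M] ranges beyond SO(N)
    here. *)
Lemma loclip_continuous f Q pe : loclip f -> cbounded Q ->
  continuous (fun M => f (upd Q pe M)).
Proof.
move=> hf [B hB] M A /nbhs_ballP[eps /= e0 hA].
have [K [K0 _ c]] := hf (Num.max B (`|M| + 1)).
(* A radius of at most 1 keeps [M'] in the bounded region where [K] is valid; the other bound makes
   the variation smaller than [eps]. *)
pose del := Num.min 1 (eps / (K + 1)).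
have K1 : 0 < K + 1 by rewrite ltr_wpDl.
have del0 : 0 < del by rewrite lt_min ltr01 divr_gt0.
apply/nbhs_ballP; exists del => // M' [_ hM']; apply: hA; rewrite -ball_normE /ball_ /=.
have dM i j : `|M i j - M' i j| <= del by exact/ltW/hM'.
have M1 i j : `|M i j| <= `|M| + 1.
  by rewrite (le_trans (mx_entry_norm _ _ _)) // lerDl.
have M2 i j : `|M' i j| <= `|M| + 1.
  rewrite -(subrK (M i j) (M' i j)) addrC; apply: (le_trans (ler_normD _ _)).
  by rewrite lerD ?mx_entry_norm // distrC (le_trans (dM i j)) // ge_min lexx.
have hc : cclose del (upd Q pe M) (upd Q pe M').
  move=> pe' i j; rewrite /upd; case: eqP => _ //.
  by rewrite subrr normr0 ltW.
have := c _ _ _ (ltW del0) (cbnd_upd pe hB M1) (cbnd_upd pe hB M2) hc.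
move=> /le_lt_trans; apply.
apply: (@le_lt_trans _ _ (K * (eps / (K + 1)))).
  by rewrite ler_wpM2l // ge_min lexx orbT.
by rewrite mulrA ltr_pdivrMr // mulrC ltr_pM2l // ltrDl.
Qed.

End LocallyLipschitz.

(** * Partial and iterated Haar integrals *)

Section Haar.
Variables (R : realType) (N d : nat) (I : ('M[R]_N -> R) -> R).
Hypothesis hI : is_haar_integral I.
Implicit Types (Q : config R d N) (f g : config R d N -> R) (pe : posedge d).

Lemma haarD (f g : 'M[R]_N -> R) : continuous f -> continuous g ->
  I (fun M => f M + g M) = I f + I g.
Proof. by case: hI => h _ _ _ _; apply: h. Qed.

Lemma haarZ (c : R) (f : 'M[R]_N -> R) : continuous f -> I (fun M => c * f M) = c * I f.
Proof. by case: hI => _ h _ _ _; apply: h. Qed.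

Lemma haarB (f g : 'M[R]_N -> R) : continuous f -> continuous g ->
  I (fun M => f M - g M) = I f - I g.
Proof.
move=> cf cg; rewrite -[in RHS]mulN1r -haarZ // -haarD //.
  by congr I; apply/funext => M; rewrite mulN1r.
by move=> M; exact: (cvgM (cvg_cst _) (cg M)).
Qed.

Lemma haar_le (f g : 'M[R]_N -> R) : continuous f -> continuous g ->
  (forall M, SOset M -> f M <= g M) -> I f <= I g.
Proof.
move=> cf cg h; rewrite -subr_ge0 -haarB //; case: hI => _ _ p _ _.
apply: p => [M|M hM]; last by rewrite subr_ge0 h.
by exact: (cvgB (cg M) (cf M)).
Qed.

Lemma haar_cst (c : R) : I (fun=> c) = c.
Proof.
have := @haarZ c (fun=> 1) (@cst_continuous _ _ _); case: hI => _ _ _ -> _.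
by rewrite mulr1.
Qed.

Lemma haar_norm (f : 'M[R]_N -> R) (K : R) : continuous f ->
  (forall M, SOset M -> `|f M| <= K) -> `|I f| <= K.
Proof.
move=> cf h; rewrite ler_norml -{1}(haar_cst (- K)) -{2}(haar_cst K).
have cc (c : R) : continuous (fun _ : 'M[R]_N => c) by exact: cst_continuous.
by apply/andP; split; apply: haar_le => // M /h; rewrite ler_norml => /andP[].
Qed.

(** Matrices in SO(N) have entries of size at most 1, so the constant of [f] for the radius max(B,
    1) survives integration unchanged. *)
Lemma loclip_haar f pe : loclip f -> loclip (fun Q => I (fun M => f (upd Q pe M))).
Proof.
move=> hf B; have [K [K0 b c]] := hf (Num.max B 1).
have S := @SOset_entry R N.
exists K; split=> // [Q hQ|Q Q' eps e0 h h' hc].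
  apply: haar_norm => [|M hM]; first by apply: loclip_continuous => //; exists B.
  by apply: b; apply: cbnd_upd => // i j; apply: S.
have cQ := @loclip_continuous _ _ _ f Q pe hf (ex_intro _ B h).
have cQ' := @loclip_continuous _ _ _ f Q' pe hf (ex_intro _ B h').
rewrite -haarB //; apply: haar_norm => [M|M hM].
  by apply: continuousB; [exact: cQ|exact: cQ'].
apply: c => //; try by [apply: cbnd_upd => // i j; apply: S].
by move=> pe' i j; rewrite /upd; case: eqP => _; rewrite ?subrr ?normr0.
Qed.

Lemma loclip_prod_int es f : loclip f -> loclip (prod_int I es f).
Proof. by elim: es => // pe es IH hf; apply: loclip_haar (IH hf). Qed.

Lemma continuous_prod_int es f Q pe : loclip f -> cbounded Q ->
  continuous (fun M => prod_int I es f (upd Q pe M)).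
Proof. by move=> hf; apply: loclip_continuous; apply: loclip_prod_int. Qed.

Lemma prod_intD es f g Q : loclip f -> loclip g -> cbounded Q ->
  prod_int I es (fun Q => f Q + g Q) Q = prod_int I es f Q + prod_int I es g Q.
Proof.
move=> hf hg; elim: es Q => //= pe es IH Q hQ.
rewrite -haarD; try exact: continuous_prod_int.
by congr I; apply/funext => M; rewrite IH //; apply: cbounded_upd.
Qed.

Lemma prod_intZ es (c : R) f Q : loclip f -> cbounded Q ->
  prod_int I es (fun Q => c * f Q) Q = c * prod_int I es f Q.
Proof.
move=> hf; elim: es Q => //= pe es IH Q hQ.
rewrite -haarZ; last exact: continuous_prod_int.
by congr I; apply/funext => M; rewrite IH //; apply: cbounded_upd.
Qed.

Lemma prod_int_le es f g Q : loclip f -> loclip g -> SOconf Q ->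
  (forall Q, SOconf Q -> f Q <= g Q) -> prod_int I es f Q <= prod_int I es g Q.
Proof.
move=> hf hg hQ h; elim: es Q hQ => [|pe es IH] Q hQ /=; first exact: h.
apply: haar_le => [||M hM]; try by apply: continuous_prod_int => //; apply: SOconf_bounded.
by apply: IH; apply: SOconf_upd.
Qed.

Lemma prod_int_cst es (c : R) Q : prod_int I es (fun=> c) Q = c.
Proof.
elim: es Q => //= pe es IH Q; rewrite -[RHS]haar_cst.
by congr I; apply/funext.
Qed.

End Haar.

(** * Derivatives along rotations *)

Section Invariance.
Variables (R : realType) (N d : nat) (I : ('M[R]_N -> R) -> R).
Hypothesis hI : is_haar_integral I.
Implicit Types (Q : config R d N) (f g : config R d N -> R) (pe : posedge d).
Implicit Types (A M : 'M[R]_N).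

Definition lmul pe A Q : config R d N := upd Q pe (A *m Q pe).

Lemma loclip_lmul pe A f : loclip f -> loclip (fun Q => f (lmul pe A Q)).
Proof.
(* The double sum dominates every row sum of [A]; adding 1 makes [c >= 1], so that the untouched
   edges obey the same estimates. *)
move=> hf B; pose c : R := (\sum_i \sum_j `|A i j|) + 1.
have c1 : 1 <= c by rewrite lerDr; do 2!apply: sumr_ge0 => *.
have c0 : 0 <= c by apply: le_trans c1.
have entry M b i j : (forall i j, `|M i j| <= b) -> `|(A *m M) i j| <= c * b.
  move=> h; have b0 : 0 <= b by apply: le_trans (h i j).
  rewrite mxE; apply: (le_trans (ler_norm_sum _ _ _)).
  apply: (@le_trans _ _ (\sum_k `|A i k| * b)).
    by apply: ler_sum => k _; rewrite normrM ler_wpM2l.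
  rewrite -mulr_suml ler_wpM2r // /c [X in _ <= X + 1](bigD1 i) //= -addrA lerDl.
  by rewrite addr_ge0 //; do 2!apply: sumr_ge0 => *.
have grow b : 0 <= b -> b <= c * b by move=> b0; rewrite ler_peMl.
have bnd b Q : 0 <= b -> cbnd b Q -> cbnd (c * b) (lmul pe A Q).
  move=> b0 h pe' i j; rewrite /lmul /upd; case: eqP => _; first exact: entry.
  by apply: le_trans (grow _ b0).
have [K [K0 b cl]] := hf (c * `|B|).
have bB Q : cbnd B Q -> cbnd `|B| Q.
  by move=> h pe' i j; apply: le_trans (ler_norm _).
exists (K * c); split=> [|Q hQ|Q Q' eps e0 h h' hc] /=; first exact: mulr_ge0.
  by rewrite (le_trans (b _ (bnd _ _ _ (bB _ hQ)))) // ler_peMr.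
rewrite -mulrA; apply: cl; rewrite ?mulr_ge0 //; try by apply: bnd => //; apply: bB.
move=> pe' i j; rewrite /lmul /upd; case: eqP => _.
  have := entry (Q pe - Q' pe) eps i j; rewrite mulmxBr !mxE; apply=> i' j'.
  by rewrite !mxE.
by apply: le_trans (grow _ e0).
Qed.

Lemma upd_comm Q pe pe' M M' : pe != pe' ->
  upd (upd Q pe M) pe' M' = upd (upd Q pe' M') pe M.
Proof.
move=> ne; apply/funext => e; rewrite /upd.
by case: (eqVneq e pe') => [->|//]; rewrite eq_sym (negbTE ne).
Qed.

Lemma lmul_upd pe pe' A M Q : pe != pe' ->
  lmul pe A (upd Q pe' M) = upd (lmul pe A Q) pe' M.
Proof.
move=> ne; rewrite /lmul upd_comm 1?eq_sym //; congr upd.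
by rewrite /upd (negbTE ne).
Qed.

Lemma prod_int_lmul_notin es pe A f Q : pe \notin es ->
  prod_int I es (fun Q => f (lmul pe A Q)) Q = prod_int I es f (lmul pe A Q).
Proof.
elim: es Q => //= pe' es IH Q; rewrite inE negb_or => /andP[ne ni].
congr I; apply/funext => M; by rewrite IH // lmul_upd.
Qed.

(** The induction descends to the last occurrence of [pe] in [es]. There the rotation commutes with
    the integrals further inside and is absorbed by left invariance. *)
Lemma prod_int_lmul es pe A f Q : pe \in es -> SOset A -> loclip f -> cbounded Q ->
  prod_int I es (fun Q => f (lmul pe A Q)) Q = prod_int I es f Q.
Proof.
move=> hpe hA hf; elim: es hpe Q => //= pe' es IH; rewrite inE.
case: (boolP (pe \in es)) => [hin _ Q hQ|hni].
  by congr I; apply/funext => M; apply: IH => //; apply: cbounded_upd.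
rewrite orbF => /eqP <- Q hQ.
rewrite -[RHS](_ : I (fun M => prod_int I es f (upd Q pe (A *m M))) = _).
  congr I; apply/funext => M; rewrite prod_int_lmul_notin //; congr prod_int.
  by apply/funext => e; rewrite /lmul /upd eqxx; case: eqP.
case: hI => _ _ _ _ inv.
by apply: (inv A (fun M => prod_int I es f (upd Q pe M))) => //; apply: continuous_prod_int.
Qed.

Lemma prod_int_norm es f Q (K : R) : loclip f -> SOconf Q ->
  (forall Q, SOconf Q -> `|f Q| <= K) -> `|prod_int I es f Q| <= K.
Proof.
move=> hf hQ h; rewrite ler_norml; apply/andP; split.
  rewrite -(prod_int_cst hI es (- K) Q); apply: prod_int_le => // [|Q' /h].
    exact: loclip_cst.
  by rewrite ler_norml => /andP[].
rewrite -[leRHS](prod_int_cst hI es K Q); apply: prod_int_le => // [|Q' /h].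
  exact: loclip_cst.
by rewrite ler_norml => /andP[].
Qed.

End Invariance.

(** * First-order expansions along a curve of rotations *)

Section Derivation.
Variables (R : realType) (N d : nat) (pe : posedge d) (X : 'M[R]_N) (rt : R -> 'M[R]_N).
Implicit Types (Q : config R d N) (f g : config R d N -> R).

(* [rt] is a curve in SO(N) through the identity with velocity [X] at [0]. *)
Definition rotation_curve :=
  (forall t, 0 <= t <= 1 -> SOset (rt t)) /\
  exists C : R, forall t, 0 <= t <= 1 ->
    forall i j, `|(rt t - 1%:M - t *: X) i j| <= C * t ^+ 2.

Hypothesis hrt : rotation_curve.

(** A derivative at t = 0 in the form of an expansion with uniform error of order t^2. Such
    estimates can be integrated directly, with no exchange of limit and integral. *)
Definition ederiv f g := [/\ loclip f, loclip g &
  exists2 C : R, 0 <= C & forall t Q, 0 <= t <= 1 -> SOconf Q ->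
    `|f (lmul pe (rt t) Q) - f Q - t * g Q| <= C * t ^+ 2].

Lemma SOset_mul (A B : 'M[R]_N) : SOset A -> SOset B -> SOset (A *m B).
Proof.
case=> h1 h2 [h3 h4]; split; first exact: orthM.
by rewrite det_mulmx h2 h4 mulr1.
Qed.

Lemma SOconf_lmul t Q : 0 <= t <= 1 -> SOconf Q -> SOconf (lmul pe (rt t) Q).
Proof. by move=> ht h; apply: SOconf_upd => //; apply: SOset_mul => //; apply hrt.1. Qed.

Lemma loclip_SO f : loclip f -> exists2 K : R, 0 <= K & forall Q, SOconf Q -> `|f Q| <= K.
Proof.
by move=> /(_ 1)[K [K0 b _]]; exists K => // Q /SOconf_cbnd; apply: b.
Qed.

(** By invariance [f] and its rotated version have equal integrals, so t times the integral of [g]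
    is at most C t^2 in absolute value; t then tends to 0. *)
Lemma prod_int_deriv (I : ('M[R]_N -> R) -> R) es f g Q :
  is_haar_integral I -> pe \in es -> SOconf Q -> ederiv f g -> prod_int I es g Q = 0.
Proof.
move=> hI hpe hQ [lf lg [C C0 h]].
have bQ := SOconf_bounded hQ.
have key t : 0 < t <= 1 -> `|prod_int I es g Q| <= C * t.
  case/andP=> t0 t1; have ht : 0 <= t <= 1 by rewrite ltW.
  have lt := loclip_lmul pe (rt t) lf.
  have E : prod_int I es (fun Q => f (lmul pe (rt t) Q) + (-1 * f Q + (- t) * g Q)) Q
      = - t * prod_int I es g Q.
    rewrite !prod_intD ?prod_intZ //; try
      by [repeat first [exact: loclip_cst | exact: lg | exact: lf | apply: loclip_add | apply: loclip_mul]].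
    rewrite prod_int_lmul //; last exact: hrt.1.
    by ring.
  rewrite -(ler_pM2l t0) -{1}(gtr0_norm t0) -normrM -normrN -mulNr -E.
  apply: prod_int_norm => //.
    by repeat first [exact: loclip_cst | exact: lg | exact: lf | exact: lt | apply: loclip_add | apply: loclip_mul].
  move=> Q' hQ'; rewrite mulN1r mulNr addrA.
  by apply: le_trans (h t Q' ht hQ') _; rewrite expr2 mulrCA mulrA mulrC mulrA mulrAC.
apply/eqP; rewrite -normr_eq0; apply/negP => /negP ne.
set a := `|_| in key ne; have a0 : 0 < a by rewrite lt_def ne normr_ge0.
have C1 : 0 < C + 1 by rewrite ltr_wpDl.
(* For this t the bound C t is at most a / 2, which contradicts a <= C t. *)
have := key (Num.min 1 (a / (2 * (C + 1)))).
rewrite lt_min ltr01 ge_min lexx /= divr_gt0 ?mulr_gt0 // => /(_ isT).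
apply/negP; rewrite -ltNge.
apply: (@le_lt_trans _ _ (C * (a / (2 * (C + 1))))).
  by rewrite ler_wpM2l // ge_min lexx orbT.
rewrite mulrA ltr_pdivrMr ?mulr_gt0 // mulrC ltr_pM2l //.
by lra.
Qed.

Lemma eq_deriv f f' g g' : f =1 f' -> g =1 g' -> ederiv f g -> ederiv f' g'.
Proof. by move=> /funext -> /funext ->. Qed.

Lemma deriv_cst (c : R) : ederiv (fun=> c) (fun=> 0).
Proof.
split; try exact: loclip_cst.
by exists 0 => // t Q _ _; rewrite subrr mulr0 subrr normr0 mul0r.
Qed.

Lemma deriv_add f f' g g' : ederiv f g -> ederiv f' g' ->
  ederiv (fun Q => f Q + f' Q) (fun Q => g Q + g' Q).
Proof.
case=> lf lg [C C0 h] [lf' lg' [C' C0' h']]; split; try exact: loclip_add.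
exists (C + C') => [|t Q ht hQ]; first exact: addr_ge0.
rewrite (_ : _ - _ = (f (lmul pe (rt t) Q) - f Q - t * g Q)
  + (f' (lmul pe (rt t) Q) - f' Q - t * g' Q)); last by ring.
by apply: (le_trans (ler_normD _ _)); rewrite [leRHS]mulrDl lerD ?h ?h'.
Qed.

Lemma deriv_mul f f' g g' : ederiv f g -> ederiv f' g' ->
  ederiv (fun Q => f Q * f' Q) (fun Q => g Q * f' Q + f Q * g' Q).
Proof.
case=> lf lg [C C0 h] [lf' lg' [C' C0' h']].
split; first exact: loclip_mul.
  by apply: loclip_add; apply: loclip_mul.
have [K K0 b1] := loclip_SO lf; have [K' K0' b2] := loclip_SO lf'.
have [L L0 b3] := loclip_SO lg; have [L' L0' b4] := loclip_SO lg'.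
exists (C * K' + (K + L) * C' + L * L') => [|t Q ht hQ].
  by rewrite !(addr_ge0, mulr_ge0).
have hQ' := SOconf_lmul ht hQ; case/andP: (ht) => t0 t1.
(* The remainder of the product: the remainder of [f] times the rotated [f'], the linear part of [f]
   times the remainder of [f'], and a term of order t^2. *)
rewrite (_ : _ - _ = (f (lmul pe (rt t) Q) - f Q - t * g Q) * f' (lmul pe (rt t) Q)
  + (f Q + t * g Q) * (f' (lmul pe (rt t) Q) - f' Q - t * g' Q)
  + g Q * g' Q * t ^+ 2); last by ring.
have t2 : `|t ^+ 2| = t ^+ 2 by rewrite ger0_norm ?sqr_ge0.
rewrite [leRHS]mulrDl; apply: (le_trans (ler_normD _ _)); apply: lerD; last first.
  by rewrite normrM t2 ler_wpM2r ?sqr_ge0 // normrM ler_pM ?b3 ?b4.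
rewrite [leRHS]mulrDl; apply: (le_trans (ler_normD _ _)); apply: lerD; rewrite normrM.
  by rewrite [leRHS]mulrAC ler_pM ?h ?b2.
rewrite -[leRHS]mulrA ler_pM ?h' //.
apply: (le_trans (ler_normD _ _)); rewrite lerD ?b1 // normrM (ger0_norm t0).
by rewrite -[leRHS]mul1r ler_pM ?b3.
Qed.

(** The inequality 1 + u <= exp u at u = x and u = -x gives 0 <= exp x - 1 - x <= x (exp x - 1); the
    sign of x decides how the last factor is bounded. *)
Lemma expR_taylor1 (x : R) : `|expR x - 1 - x| <= x ^+ 2 * expR `|x|.
Proof.
have h1 := expR_ge1Dx x.
rewrite ger0_norm; last by lra.
have h2 : expR x - 1 <= x * expR x.
  have h := expR_ge1Dx (- x).
  have : (1 - x) * expR x <= 1.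
    by rewrite -[leRHS](@expR0 R) -(addNr x) expRD ler_wpM2r ?expR_ge0.
  by rewrite mulrBl mul1r; lra.
apply: (@le_trans _ _ (x * (expR x - 1))); first by rewrite mulrBr mulr1; lra.
case: (leP 0 x) => x0.
  by rewrite expr2 -mulrA ler_wpM2l // ger0_norm.
rewrite (_ : x * (_ - 1) = - x * (1 - expR x)); last by ring.
rewrite (_ : x ^+ 2 * _ = - x * (- x * expR `|x|)); last by ring.
have x1 : 0 <= - x by rewrite oppr_ge0 ltW.
rewrite ler_wpM2l //.
apply: (@le_trans _ _ (- x)); first by lra.
by rewrite -[leLHS]mulr1 ler_wpM2l // -expR0 ler_expR.
Qed.

Lemma deriv_exp f g : ederiv f g -> ederiv (fun Q => expR (f Q)) (fun Q => g Q * expR (f Q)).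
Proof.
case=> lf lg [C C0 h]; have le := loclip_exp lf; split=> //; first exact: loclip_mul.
have [L L0 b3] := loclip_SO lg; have [K K0 b1] := loclip_SO le.
exists (K * ((L + C) ^+ 2 * expR (L + C) + C)) => [|t Q ht hQ].
  by rewrite !(addr_ge0, mulr_ge0, expR_ge0).
case/andP: (ht) => t0 t1.
set u := f (lmul pe (rt t) Q); set x := u - f Q.
(* The increment of [f] is of order t because t^2 <= t on the unit interval. *)
have hx : `|x| <= (L + C) * t.
  rewrite (_ : x = t * g Q + (x - t * g Q)); last by ring.
  apply: (le_trans (ler_normD _ _)); rewrite mulrDl lerD //.
    by rewrite normrM (ger0_norm t0) mulrC ler_wpM2r ?b3.
  apply: (le_trans (h _ _ ht hQ)); rewrite ler_wpM2l // expr2.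
  by rewrite -[leRHS]mulr1 ler_wpM2l.
rewrite (_ : expR u = expR (f Q) * expR x); last by rewrite -expRD addrC subrK.
rewrite (_ : _ - _ = expR (f Q) * ((expR x - 1 - x) + (x - t * g Q))); last by ring.
rewrite normrM -[leRHS]mulrA ler_pM ?b1 //.
apply: (le_trans (ler_normD _ _)); rewrite mulrDl lerD ?h //.
apply: (le_trans (expR_taylor1 x)); rewrite [leRHS]mulrAC -exprMn.
have hx1 : `|x| <= L + C.
  by apply: (le_trans hx); rewrite -[leRHS]mulr1 ler_wpM2l // addr_ge0.
rewrite ler_pM ?sqr_ge0 ?expR_ge0 ?ler_expR //.
by rewrite -real_normK ?num_real // lerXn2r ?nnegrE // mulr_ge0 // addr_ge0.
Qed.

Lemma deriv_sum (J : Type) (r : seq J) (F G : J -> config R d N -> R) :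
  (forall i, ederiv (F i) (G i)) ->
  ederiv (fun Q => \sum_(i <- r) F i Q) (fun Q => \sum_(i <- r) G i Q).
Proof.
move=> h; elim: r => [|i r IH].
  by apply: eq_deriv (deriv_cst 0) => Q; rewrite big_nil.
by apply: eq_deriv (deriv_add (h i) IH) => Q; rewrite big_cons.
Qed.

Definition ederiv_mx (F G : config R d N -> 'M[R]_N) :=
  forall i j, ederiv (fun Q => F Q i j) (fun Q => G Q i j).

Lemma deriv_mulmx F F' G G' : ederiv_mx F G -> ederiv_mx F' G' ->
  ederiv_mx (fun Q => F Q *m F' Q) (fun Q => G Q *m F' Q + F Q *m G' Q).
Proof.
move=> h h' i j.
apply: eq_deriv (deriv_sum (index_enum 'I_N) (fun k => deriv_mul (h i k) (h' k j))) => Q.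
  by rewrite mxE.
by rewrite !mxE big_split.
Qed.

Lemma deriv_trmx F G : ederiv_mx F G -> ederiv_mx (fun Q => (F Q)^T) (fun Q => (G Q)^T).
Proof. by move=> h i j; apply: eq_deriv (h j i) => Q; rewrite mxE. Qed.

Lemma deriv_cstmx M : ederiv_mx (fun=> M) (fun=> 0).
Proof. by move=> i j; apply: eq_deriv (deriv_cst (M i j)) => Q; rewrite ?mxE. Qed.

Lemma deriv_tr F G : ederiv_mx F G -> ederiv (fun Q => \tr (F Q)) (fun Q => \tr (G Q)).
Proof. by move=> h; apply: deriv_sum. Qed.

Lemma deriv_pe : ederiv_mx (fun Q => Q pe) (fun Q => X *m Q pe).
Proof.
move=> i j; split; first exact: loclip_coord.
  by apply: loclip_mulmx; [exact: loclip_cstmx|exact: loclip_coord].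
(* The remainder of the curve is multiplied by an orthogonal matrix: N products, each with a second
   factor of size at most 1. *)
case: hrt => _ [C hC]; exists (N%:R * `|C|) => [|t Q ht hQ]; first exact: mulr_ge0.
rewrite /lmul /upd eqxx.
have -> : (rt t *m Q pe) i j - Q pe i j - t * (X *m Q pe) i j =
    ((rt t - 1%:M - t *: X) *m Q pe) i j.
  by rewrite !mulmxBl mul1mx -scalemxAl !mxE.
rewrite [X in `|X|]mxE; apply: (le_trans (ler_norm_sum _ _ _)).
rewrite -mulrA -[N in N%:R]card_ord mulr_natl -sumr_const.
apply: ler_sum => k _; rewrite normrM -[leRHS]mulr1 ler_pM //.
  apply: (le_trans (hC t ht i k)); rewrite ler_wpM2r ?sqr_ge0 //; exact: ler_norm.
exact: SOset_entry.
Qed.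

Lemma deriv_other pe' : pe' != pe -> ederiv_mx (fun Q => Q pe') (fun=> 0).
Proof.
move=> ne i j; split; first exact: loclip_coord.
  exact: loclip_cst.
exists 0 => // t Q _ _; rewrite /lmul /upd (negbTE ne) mxE.
by rewrite subrr mulr0 subrr normr0 mul0r.
Qed.

Definition demat Q (a : edge d) : 'M[R]_N :=
  if a.1 == pe then if a.2 then X *m Q pe else (X *m Q pe)^T else 0.

Lemma deriv_emat a : ederiv_mx (fun Q => emat Q a) (fun Q => demat Q a).
Proof.
case: a => [[x i] b]; rewrite /demat /=; case: eqP => [->|/eqP ne].
  by case: b; [exact: deriv_pe|exact: deriv_trmx deriv_pe].
case: b; first exact: deriv_other.
move=> j k; apply: eq_deriv (deriv_trmx (deriv_other ne) j k) => Q //.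
by rewrite trmx0.
Qed.

Fixpoint dwmat Q (l : seq (edge d)) : 'M[R]_N :=
  if l is a :: l' then demat Q a *m wmat Q l' + emat Q a *m dwmat Q l' else 0.

Lemma deriv_wmat l : ederiv_mx (fun Q => wmat Q l) (fun Q => dwmat Q l).
Proof.
elim: l => [|a l IH] /=; first exact: deriv_cstmx.
exact: deriv_mulmx (deriv_emat a) IH.
Qed.

Lemma deriv_wilson l : ederiv (fun Q => wilson Q l) (fun Q => \tr (dwmat Q l)).
Proof. exact: deriv_tr (deriv_wmat l). Qed.

Fixpoint dprod Q (s : seq (seq (edge d))) : R :=
  if s is l :: s' then
    \tr (dwmat Q l) * \prod_(l <- s') wilson Q l + wilson Q l * dprod Q s'
  else 0.

Lemma deriv_prod s : ederiv (fun Q => \prod_(l <- s) wilson Q l) (fun Q => dprod Q s).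
Proof.
elim: s => [|l s IH].
  by apply: eq_deriv (deriv_cst 1) => Q; rewrite ?big_nil.
by apply: eq_deriv (deriv_mul (deriv_wilson l) IH) => Q; rewrite ?big_cons.
Qed.

Lemma deriv_gibbs L beta :
  ederiv (@gibbs_weight R d N L beta)
    (fun Q => N%:R * beta * (\sum_(p <- PplusL L) \tr (dwmat Q p)) * gibbs_weight L beta Q).
Proof.
apply: deriv_exp; apply: eq_deriv (deriv_mul (deriv_cst (N%:R * beta))
  (deriv_sum (PplusL L) deriv_wilson)) => Q //=.
by rewrite mul0r add0r.
Qed.

End Derivation.

(** * Sums over the Lie algebra *)

Section SkewBasis.
Variables (R : realType) (N : nat).
Implicit Types (A B : 'M[R]_N) (a b : 'I_N).

(** Generator of the rotations in the (a,b)-plane. Sums over all ordered pairs meet each plane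
    twice, with opposite generators, whence the factor 2 in the trace identities. *)
Definition rotgen a b : 'M[R]_N := delta_mx a b - delta_mx b a.

Lemma skewT a b : (rotgen a b)^T = - rotgen a b.
Proof. by rewrite /rotgen linearB /= !trmx_delta opprB. Qed.

(** In the plane the curve is the square of a half-speed rotation with coefficient t / 2 on [X]. A
    square root replaces trigonometric functions. *)
Lemma rotation_curve_rotgen a b : exists rt, rotation_curve (rotgen a b) rt.
Proof.
have [<-|ne] := eqVneq a b.
  exists (fun=> 1%:M); split=> [t _|]; first by split; rewrite ?det1 // trmx1 mulmx1.
  exists 0 => t _ i j; by rewrite /rotgen !subrr scaler0 subr0 mxE normr0 mul0r.
have ne' : b != a by rewrite eq_sym.
pose X := rotgen a b; pose P : 'M[R]_N := delta_mx a a + delta_mx b b.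
have XX : X *m X = - P.
  rewrite /X /P /rotgen !(mulmxBl, mulmxBr) !mul_delta_mx_cond !eqxx (negbTE ne) (negbTE ne').
  by rewrite !mulr0n !mulr1n; apply/matrixP => i j; rewrite !mxE; ring.
have XP : X *m P = X.
  rewrite /X /P /rotgen !(mulmxBl, mulmxDr) !mul_delta_mx_cond !eqxx (negbTE ne) (negbTE ne').
  by rewrite !mulr0n !mulr1n; apply/matrixP => i j; rewrite !mxE; ring.
have PX : P *m X = X.
  rewrite /X /P /rotgen !(mulmxBr, mulmxDl) !mul_delta_mx_cond !eqxx (negbTE ne) (negbTE ne').
  by rewrite !mulr0n !mulr1n; apply/matrixP => i j; rewrite !mxE; ring.
have PP : P *m P = P.
  rewrite /P !(mulmxDr, mulmxDl) !mul_delta_mx_cond !eqxx (negbTE ne) (negbTE ne').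
  by rewrite !mulr0n !mulr1n; apply/matrixP => i j; rewrite !mxE; ring.
have PT : P^T = P by rewrite /P linearD /= !trmx_delta.
have XT : X^T = - X by exact: skewT.
(* On the plane [P] and [X] act as 1 and i, so this is the product of the complex numbers 1 + u + iv
   and 1 + u' + iv'. *)
have prodE (u v u' v' : R) :
    (1%:M + u *: P + v *: X) *m (1%:M + u' *: P + v' *: X) =
    1%:M + (u + u' + u * u' - v * v') *: P + (v + v' + u * v' + v * u') *: X.
  rewrite !(mulmxDl, mulmxDr) !mul1mx !mulmx1 -!scalemxAl -!scalemxAr !XX !XP !PX !PP.
  by apply/matrixP => i j; rewrite !mxE; ring.
pose c (t : R) := Num.sqrt (1 - (t / 2) ^+ 2).
pose S t := 1%:M + (c t - 1) *: P + (t / 2) *: X.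
have cE t : 0 <= t <= 1 -> c t ^+ 2 = 1 - (t / 2) ^+ 2.
  by case/andP=> t0 t1; rewrite sqr_sqrtr //; nra.
have orthS t : 0 <= t <= 1 -> orth (S t).
  have ST : (S t)^T = 1%:M + (c t - 1) *: P + (- (t / 2)) *: X.
    rewrite /S [LHS](raddfD (@trmx R N N)) [in LHS](raddfD (@trmx R N N)).
    by rewrite /= trmx1 !(linearZ_LR (@trmx R N N)) /= PT XT scalerN scaleNr.
  move=> /cE h; rewrite /orth ST prodE.
  have -> : c t - 1 + (c t - 1) + (c t - 1) * (c t - 1) - - (t / 2) * (t / 2) = 0.
    by rewrite (_ : _ - _ = c t ^+ 2 - 1 + (t / 2) ^+ 2); [rewrite h; ring|ring].
  have -> : - (t / 2) + t / 2 + (c t - 1) * (t / 2) + - (t / 2) * (c t - 1) = 0 by ring.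
  by rewrite !scale0r !addr0.
(* As a square, [S *m S] has determinant [(\det S) ^+ 2 = 1] for free. *)
exists (fun t => S t *m S t); split=> [t ht|].
  have o := orthS t ht; split; first exact: orthM.
  by have := congr1 determinant o; rewrite !det_mulmx det_tr det1.
(* The remainder is -(t^2 / 2) P + (c - 1) t X. With 0 <= 1 - c <= t^2 / 4 and entries of [P] and
   [X] at most 2, it stays below 3/2 t^2. *)
exists 2 => t ht i j; case/andP: (ht) => t0 t1.
have c0 : 0 <= c t by apply: sqrtr_ge0.
have hc := cE t ht.
rewrite prodE.
have -> : c t - 1 + (c t - 1) + (c t - 1) * (c t - 1) - t / 2 * (t / 2) = - (t ^+ 2 / 2).
  rewrite (_ : _ - _ = c t ^+ 2 - 1 - (t / 2) ^+ 2); last by ring.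
  by rewrite hc; field.
have Pb : `|P i j| <= 2.
  rewrite !mxE; apply: (le_trans (ler_normD _ _)).
  rewrite (_ : 2 = 1 + 1 :> R); last by [].
  by rewrite lerD // normr_nat lern1 leq_b1.
have Xb : `|X i j| <= 2.
  rewrite !mxE; apply: (le_trans (ler_normB _ _)).
  rewrite (_ : 2 = 1 + 1 :> R); last by [].
  by rewrite lerD // normr_nat lern1 leq_b1.
have -> : (1%:M + - (t ^+ 2 / 2) *: P + (t / 2 + t / 2 + (c t - 1) * (t / 2) + t / 2 * (c t - 1)) *: X
    - 1%:M - t *: rotgen a b) i j = - (t ^+ 2 / 2) * P i j + ((c t - 1) * t) * X i j.
  by rewrite -/X !mxE; field.
have c1 : 1 - c t <= t ^+ 2 / 4.
  have : (1 - c t) * (1 + c t) = t ^+ 2 / 4.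
    by rewrite (_ : _ * _ = 1 - c t ^+ 2); [rewrite hc; field|ring].
  have : c t <= 1.
    by rewrite -(@ler_pXn2r _ 2) ?nnegrE // hc expr1n gerBl sqr_ge0.
  by nra.
have c2 : `|(c t - 1) * t| <= t ^+ 2 / 4.
  rewrite normrM distrC (ger0_norm t0).
  have le1 : 0 <= 1 - c t.
    rewrite subr_ge0 -(@ler_pXn2r _ 2) ?nnegrE // hc expr1n gerBl sqr_ge0 //.
  by rewrite ger0_norm // -[leRHS]mulr1 ler_pM.
apply: (le_trans (ler_normD _ _)); rewrite !normrM in c2 *.
rewrite normrN (ger0_norm (_ : 0 <= t ^+ 2 / 2)); last by rewrite divr_ge0 ?sqr_ge0.
have := ler_pM (_ : 0 <= t ^+ 2 / 2) (normr_ge0 (P i j)) (lexx _) Pb.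
have := ler_pM (_ : 0 <= `|c t - 1| * `|t|) (normr_ge0 (X i j)) c2 Xb.
have t2 : 0 <= t ^+ 2 by apply: sqr_ge0.
move=> /(_ (mulr_ge0 (normr_ge0 _) (normr_ge0 _))) h1 /(_ (divr_ge0 t2 (ler0n _ 2))) h2.
by lra.
Qed.

Lemma tr_delta_mulmx a b A : \tr (delta_mx a b *m A) = A b a.
Proof.
rewrite /mxtrace (bigD1 a) //= big1 ?addr0 => [|i ne].
  rewrite mxE (bigD1 b) //= big1 ?addr0 => [|k nk]; first by rewrite mxE !eqxx mul1r.
  by rewrite mxE (negbTE nk) andbF mul0r.
by rewrite mxE big1 // => k _; rewrite mxE (negbTE ne) mul0r.
Qed.

Lemma tr_delta_mulmx2 a b a' b' A B :
  \tr (delta_mx a b *m A *m (delta_mx a' b' *m B)) = A b a' * B b' a.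
Proof.
rewrite -mulmxA tr_delta_mulmx mxE (bigD1 a') //= big1 ?addr0 => [|k nk].
  congr (_ * _); rewrite mxE (bigD1 b') //= big1 ?addr0 => [|k nk].
    by rewrite mxE !eqxx mul1r.
  by rewrite mxE (negbTE nk) andbF mul0r.
by rewrite mxE big1 ?mulr0 // => j _; rewrite mxE (negbTE nk) mul0r.
Qed.

Lemma tr_skew a b A : \tr (rotgen a b *m A) = A b a - A a b.
Proof. by rewrite mulmxBl linearB /= !tr_delta_mulmx. Qed.

Lemma sum_skew_pair A B :
  \sum_a \sum_b \tr (rotgen a b *m A) * \tr (rotgen a b *m B) =
  2 * (\tr (A *m B^T) - \tr (A *m B)).
Proof.
pose S := \sum_a \sum_b A a b * B a b; pose T := \sum_a \sum_b A a b * B b a.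
have -> : \tr (A *m B^T) = S.
  by apply: eq_bigr => a _; rewrite mxE; apply: eq_bigr => b _; rewrite mxE.
have -> : \tr (A *m B) = T by apply: eq_bigr => a _; rewrite mxE.
(* Writing each sum also with a and b exchanged makes the identity hold term by term. *)
have S' : S = \sum_a \sum_b A b a * B b a by rewrite /S exchange_big.
have T' : T = \sum_a \sum_b A b a * B a b by rewrite /T exchange_big.
rewrite (_ : 2 * _ = S + S - T - T); last by ring.
rewrite {1}S' {1}T' /S /T -!big_split -!sumrB; apply: eq_bigr => a _.
rewrite -!big_split -!sumrB; apply: eq_bigr => b _.
by rewrite !tr_skew /=; ring.
Qed.

Lemma sum_skew_self A B :
  \sum_a \sum_b \tr (rotgen a b *m A *m (rotgen a b *m B)) =
  2 * (\tr (A *m B^T) - \tr A * \tr B).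
Proof.
pose S := \sum_a \sum_b A a b * B a b; pose T := \sum_a \sum_b A a a * B b b.
have -> : \tr (A *m B^T) = S.
  by apply: eq_bigr => a _; rewrite mxE; apply: eq_bigr => b _; rewrite mxE.
have -> : \tr A * \tr B = T.
  by rewrite /mxtrace big_distrl; apply: eq_bigr => a _; rewrite big_distrr.
have S' : S = \sum_a \sum_b A b a * B b a by rewrite /S exchange_big.
have T' : T = \sum_a \sum_b A b b * B a a by rewrite /T exchange_big.
rewrite (_ : 2 * _ = S + S - T - T); last by ring.
rewrite {1}S' {1}T' /S /T -!big_split -!sumrB; apply: eq_bigr => a _.
rewrite -!big_split -!sumrB; apply: eq_bigr => b _.
rewrite /rotgen !(mulmxBl, mulmxBr) !linearB /= !tr_delta_mulmx2.
by ring.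
Qed.

End SkewBasis.

(** * Derivatives of words, summed over the generators *)

Section WordDerivative.
Variables (R : realType) (N d : nat) (pe : posedge d).
Implicit Types (Q : config R d N) (l u v w : seq (edge d)) (X : 'M[R]_N).

Definition esign (e a : edge d) : R :=
  if a == e then 1 else if a == einv e then -1 else 0.

(* Differentiating [Q_e] in direction [X] inserts [X] before [e], and
   differentiating [Q_{e^{-1}}] inserts [-X] after [e^{-1}]. *)
Definition inspos (e : edge d) l (k : nat) : nat := (k + (nth e l k == einv e))%N.

Let e : edge d := (pe, true).

(** Leibniz rule. For an inverted letter the derivative of Q^T is Q^T X^T = -Q^T X, which explains
    the sign and the insertion after the letter. *)
Lemma dwmatE X Q l : X^T = - X ->
  dwmat pe X Q l = \sum_(k < size l) esign e (nth e l k) *: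
    (wmat Q (take (inspos e l k) l) *m X *m wmat Q (drop (inspos e l k) l)).
Proof.
move=> XT; elim: l => [|a l IH] /=; first by rewrite big_ord0.
rewrite big_ord_recl IH mulmx_sumr; congr (_ + _); last first.
  by apply: eq_bigr => k _; rewrite -scalemxAr /= !mulmxA.
rewrite /inspos /esign /demat /= add0n /e.
case: a => [pe' b] /=; rewrite -[_ == (pe, true)]/((pe' == pe) && (b == true)).
have -> : ((pe', b) == einv (pe, true)) = (pe' == pe) && (b == false) by case: (pe).
case: eqP => [->|_]; last by rewrite !andFb scale0r mul0mx.
rewrite !andTb; case: b => /=.
  by rewrite scale1r mul1mx mulmxA; case: (pe).
by rewrite take0 drop0 trmx_mul XT mulmxN mulNmx scaleN1r /= mulmx1; case: (pe).
Qed.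

(** One [X] stands in front of the word, the other at an insertion point; the two pieces between
    them are the A and B of [sum_skew_self]. *)
Lemma sum_skew_dwmat Q w :
  \sum_a \sum_b \tr (rotgen R a b *m dwmat pe (rotgen R a b) Q w) =
  2 * \sum_(k < size w) esign e (nth e w k) *
    (\tr (wmat Q (take (inspos e w k) w) *m (wmat Q (drop (inspos e w k) w))^T)
     - wilson Q (take (inspos e w k) w) * wilson Q (drop (inspos e w k) w)).
Proof.
under eq_bigr => a _ do under eq_bigr => b _ do
  rewrite dwmatE ?skewT // mulmx_sumr linear_sum /=.
under eq_bigr => a _ do rewrite exchange_big /=.
rewrite exchange_big /= mulr_sumr; apply: eq_bigr => k _.
rewrite mulrCA -sum_skew_self mulr_sumr; apply: eq_bigr => a _.
rewrite mulr_sumr; apply: eq_bigr => b _.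
by rewrite -scalemxAr mxtraceZ !mulmxA.
Qed.

(** Cyclicity of the trace moves the inserted [X] to the front, which rotates [v] to the insertion
    point; [sum_skew_pair] then merges the two traces. *)
Lemma sum_skew_dwmat_pair Q w v :
  \sum_a \sum_b \tr (rotgen R a b *m wmat Q w) * \tr (dwmat pe (rotgen R a b) Q v) =
  2 * \sum_(k < size v) esign e (nth e v k) *
    (\tr (wmat Q w *m (wmat Q (rot (inspos e v k) v))^T)
     - wilson Q (w ++ rot (inspos e v k) v)).
Proof.
under eq_bigr => a _ do under eq_bigr => b _ do
  rewrite dwmatE ?skewT // linear_sum mulr_sumr /=.
under eq_bigr => a _ do rewrite exchange_big /=.
rewrite exchange_big /= mulr_sumr; apply: eq_bigr => k _.
rewrite mulrCA /wilson -/(wmat _ _) wmat_cat -sum_skew_pair mulr_sumr; apply: eq_bigr => a _.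
rewrite mulr_sumr; apply: eq_bigr => b _.
rewrite mxtraceZ mulrCA; congr (_ * (_ * _)).
by rewrite -mulmxA mxtrace_mulC /rot wmat_cat mulmxA.
Qed.

End WordDerivative.

(** * Splittings and deformations of words *)

Section PointwiseWords.
Variables (R : realType) (N d : nat) (Q : config R d N).
Hypothesis hQ : SOconf Q.
Implicit Types (e f a : edge d) (l u v w r p : seq (edge d)).
Local Notation W := (wilson Q).

Lemma wilson_cancel u v a : W (u ++ a :: einv a :: v) = W (u ++ v).
Proof.
rewrite /wilson -!/(wmat Q _) !wmat_cat /= -!/(wmat Q _) (mulmxA (emat Q a)).
by rewrite emat_mul_einv // mul1mx.
Qed.

Lemma wilson_conj t a : W (a :: rcons t (einv a)) = W t.
Proof.
rewrite -cats1 -[a :: _]cat1s catA wilson_catC /=.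
have := wilson_cancel [::] t (einv a).
by rewrite einvK.
Qed.

Lemma tr_wmat_trmx w v : \tr (wmat Q w *m (wmat Q v)^T) = W (w ++ Defs.pinv v).
Proof. by rewrite /wilson -/(wmat Q _) wmat_cat wmat_pinv. Qed.

Lemma esign_self e : esign R e e = 1. Proof. by rewrite /esign eqxx. Qed.

Lemma esign_einv e : esign R e (einv e) = -1.
Proof. by rewrite /esign einv_eqF eqxx. Qed.

Lemma esign0 e a : a != e -> a != einv e -> esign R e a = 0.
Proof. by rewrite /esign => /negbTE-> /negbTE->. Qed.

Lemma esignV e f a : (f == e) || (f == einv e) ->
  esign R e f * esign R e a = esign R f a.
Proof.
case/orP=> /eqP ->; first by rewrite esign_self mul1r.
rewrite esign_einv /esign einvK; have [->|_] := eqVneq a e.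
  by rewrite eq_sym einv_eqF mulr1.
by case: ifP => _; rewrite mulN1r ?opprK ?oppr0.
Qed.

Lemma pinv_cat u v : Defs.pinv (u ++ v) = Defs.pinv v ++ Defs.pinv u.
Proof. by rewrite /Defs.pinv map_cat rev_cat. Qed.

Lemma pinv_cons a u : Defs.pinv (a :: u) = rcons (Defs.pinv u) (einv a).
Proof. by rewrite /Defs.pinv /= rev_cons. Qed.

Lemma pinv_rcons a u : Defs.pinv (rcons u a) = einv a :: Defs.pinv u.
Proof. by rewrite /Defs.pinv map_rcons rev_rcons. Qed.

(* The word at location [x] of a loop, rotated so that the insertion point of
   the derivative of the letter [f] comes first. *)
Definition pword e f r := if f == e then f :: r else rcons r f.


Lemma size_pword e f r : size (pword e f r) = (size r).+1.
Proof. by rewrite /pword; case: eqP => //; rewrite size_rcons. Qed.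

(** The splitting of the cyclic word [f :: r] at its head and at place [j] of [r], before cores are
    taken. Letters other than [f] and its inverse will carry coefficient 0. *)
Definition split0 f r j :=
  if nth f r j == f then (f :: drop j.+1 r, rcons (take j r) f)
  else (drop j.+1 r, take j r).

(** Cutting at the letter [f] itself leaves an empty word, of trace N. At any other occurrence of
    the edge the two pieces agree, up to rotation or conjugation, with those of the splitting. *)
Lemma sum_split_pword e f r : (f == e) || (f == einv e) ->
  let w := pword e f r in
  esign R e f * \sum_(k < size w) esign R e (nth e w k) *
    (W (take (inspos e w k) w) * W (drop (inspos e w k) w)) =
  N%:R * W (f :: r) + \sum_(j < size r) esign R f (nth f r j) *
    (W (split0 f r j).1 * W (split0 f r j).2).
Proof.
move=> hf; rewrite /= mulr_sumr size_pword.
rewrite [LHS](eq_bigr (fun k : 'I__ => esign R f (nth e (pword e f r) k) *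
    (W (take (inspos e (pword e f r) k) (pword e f r)) *
     W (drop (inspos e (pword e f r) k) (pword e f r))))); last first.
  by move=> k _; rewrite [LHS]mulrA esignV.
case/orP: (hf) => /eqP E; rewrite /pword E ?eqxx ?einv_eqF.
  rewrite big_ord_recl /inspos /= eq_sym einv_eqF take0 drop0 esign_self mul1r wilson_nil.
  congr (_ + _); apply: eq_bigr => -[j hj] _ /=.
  rewrite /split0 !add0n.
  set a := nth e r j.
  have [ae|ne] := eqVneq a e.
    rewrite ae eq_sym einv_eqF addn0 /= (drop_nth e hj) -/a ae.
    congr (_ * _); rewrite mulrC; congr (_ * _).
    by rewrite -cats1 wilson_catC.
  have [ai|ni] := eqVneq a (einv e); last by rewrite esign0 // !mul0r.
  rewrite addn1 /= (take_nth e hj) -/a ai wilson_conj.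
  by congr (_ * _); rewrite mulrC.
rewrite big_ord_recr [LHS]addrC /=; congr (_ + _).
  rewrite /inspos nth_rcons ltnn !eqxx addn1 -(size_rcons r (einv e)).
  by rewrite take_size drop_size esign_self mul1r wilson_nil mulrC -cats1 wilson_catC.
apply: eq_bigr => -[j hj] _; rewrite /inspos /split0 /=.
rewrite nth_rcons hj (set_nth_default e (einv e)) // -(cats1 r) takel_cat; last first.
  by case: (_ == _); rewrite ?addn1 ?addn0 // ltnW.
rewrite cats1 drop_rcons; last by case: (_ == _); rewrite ?addn1 ?addn0 // ltnW.
set a := nth e r j.
have [ai|ni] := eqVneq a (einv e).
  rewrite addn1 (take_nth e hj) -/a ai /=; congr (_ * _); rewrite mulrC; congr (_ * _).
  by rewrite -cats1 wilson_catC.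
have [ae|ne] := eqVneq a e; last by rewrite esign0 ?einvK // !mul0r.
rewrite addn0 /= (drop_nth e hj) -/a ae rcons_cons wilson_conj.
by congr (_ * _); rewrite mulrC.
Qed.

(* [c ++ a :: dd] is the plaquette, [a] being the letter [e] or [e^{-1}]. *)
Lemma deform_pword_aux e f a r c dd :
  (f == e) || (f == einv e) -> (a == e) || (a == einv e) ->
  let w := pword e f r in
  let v := if a == e then a :: dd ++ c else dd ++ rcons c a in
  esign R f a * (W (w ++ Defs.pinv v) - W (w ++ v)) =
  if a == f then
    W (Defs.pinv c ++ Defs.pinv dd ++ r) - W (f :: dd ++ c ++ f :: r)
  else
    W (dd ++ c ++ r) - W (f :: Defs.pinv c ++ Defs.pinv dd ++ f :: r).
Proof.
move=> hf ha w v; rewrite /w /v /pword {w v}.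
case/orP: hf => /eqP ->; case/orP: ha => /eqP ->; rewrite ?eqxx ?einv_eqF.
- rewrite esign_self mul1r pinv_cons pinv_cat -rcons_cat /= wilson_conj; congr (_ - _).
    by rewrite wilson_catC -catA.
  by rewrite -cat_cons wilson_catC /= -catA.
- rewrite esign_einv mulN1r opprB pinv_cat pinv_rcons einvK -!rcons_cat /= wilson_conj.
  congr (_ - _); first by rewrite wilson_catC -catA.
  by rewrite -cat_cons wilson_catC /= -catA.
- rewrite [e == _]eq_sym einv_eqF -{2}(einvK e) esign_einv mulN1r opprB !cat_rcons.
  rewrite pinv_cons pinv_cat -{2}(einvK e) wilson_cancel; congr (_ - _).
    by rewrite wilson_catC -catA.
  by rewrite wilson_catC /= -!cats1 -!catA.
- rewrite esign_self mul1r !cat_rcons pinv_cat pinv_rcons /= wilson_cancel; congr (_ - _).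
    by rewrite wilson_catC -catA.
  by rewrite wilson_catC /= -cats1 -!catA.
Qed.

(** The plaquette meets the edge exactly once, so one term of the sum survives; [a] is the letter it
    carries there. *)
Lemma deform_pword e f r p : (f == e) || (f == einv e) ->
  uniq p -> ~~ ((e \in p) && (einv e \in p)) -> (e \in p) || (einv e \in p) ->
  let w := pword e f r in
  esign R e f * \sum_(k < size p) esign R e (nth e p k) *
    (W (w ++ Defs.pinv (rot (inspos e p k) p)) - W (w ++ rot (inspos e p k) p)) =
  W (deform false (f :: r) 0 p) - W (deform true (f :: r) 0 p).
Proof.
move=> hf up nb hp /=.
pose a := if e \in p then e else einv e.
have ap : a \in p by rewrite /a; case: ifP hp => // _; rewrite orFb.
have hk : (index a p < size p)%N by rewrite index_mem.
rewrite (bigD1 (Ordinal hk)) //= big1 ?addr0; last first.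
  move=> k; rewrite -val_eqE /= => ne.
  have kp : nth e p k \in p by rewrite mem_nth.
  have na : nth e p k != a.
    by apply: contra ne => /eqP <-; rewrite index_uniq.
  rewrite esign0 ?mul0r //; move: na; rewrite /a.
    case: ifP => // einp _; apply: contraFneq einp => <-; exact: mem_nth.
  case: ifP => // einp _; apply: contra nb => /eqP h.
  by rewrite einp -h mem_nth.
have aE : (a == e) || (a == einv e) by rewrite /a; case: ifP; rewrite eqxx ?orbT.
rewrite nth_index // mulrA esignV // /inspos nth_index //.
have dE := drop_nth e hk; have tE := take_nth e hk; rewrite nth_index // in dE tE.
have fa : (f \in p) = (a == f).
  rewrite /a; case/orP: hf => /eqP ->.
    by case: ifP => ?; rewrite ?eqxx ?einv_eqF.
  move: hp nb; case: (e \in p) => /= [_ /negbTE ->|-> _]; last by rewrite eqxx.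
  by rewrite eq_sym einv_eqF.
have := deform_pword_aux r (take (index a p) p) (drop (index a p).+1 p) hf aE.
rewrite /deform rot0 fa.
have -> : rot (index a p + (a == einv e)) p = if a == e then a :: drop (index a p).+1 p ++ take (index a p) p
    else drop (index a p).+1 p ++ rcons (take (index a p) p) a.
  rewrite /rot; case/orP: aE => /eqP aE.
    by rewrite aE eq_sym einv_eqF eqxx addn0 -aE dE.
  by rewrite aE eqxx einv_eqF addn1 -aE tE.
move=> ->; case: eqP => [->|ne]; rewrite !wilson_core //.
suff -> : einv f = a by [].
by case/orP: hf ne => /eqP ->; case/orP: aE => /eqP ->; rewrite ?einvK.
Qed.

End PointwiseWords.

(** * Locations under rotation, and plaquettes at an edge *)

Section Locations.
Variables (R : realType) (d : nat).
Implicit Types (e f a : edge d) (l r p : seq (edge d)) (v : vtx d).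

Lemma rot_nth e l x : (x < size l)%N ->
  rot x l = nth e l x :: (drop x.+1 l ++ take x l).
Proof. by move=> hx; rewrite /rot (drop_nth e). Qed.

Lemma nth_rot_loc e l x y : (x < size l)%N -> (y < size l)%N ->
  nth e (rot x l) ((y + size l - x) %% size l) = nth e l y.
Proof.
move=> hx hy; rewrite /rot nth_cat size_drop.
have [le|lt] := leqP x y.
  rewrite -addnBAC // modnDr modn_small; last by lia.
  by rewrite ltn_sub2r // nth_drop subnKC.
rewrite modn_small; last by lia.
rewrite ifN; last by rewrite -leqNgt; lia.
by rewrite nth_take; [congr nth; lia|lia].
Qed.

(** The shift sends the locations y > x onto 1, ..., n - x - 1 and those with y < x onto n - x, ...,
    n - 1. *)
Lemma sum_rot_loc (V : zmodType) n x (F : nat -> V) : (x < n)%N ->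
  \sum_(0 <= y < n | y != x) F ((y + n - x) %% n)%N = \sum_(j < n.-1) F j.+1.
Proof.
move=> hx; have n0 : (0 < n)%N by lia.
rewrite -(big_mkord xpredT (fun j => F j.+1)) -(big_add1 _ _ 0 n xpredT).
rewrite (@big_cat_nat _ _ _ (n - x) 1 n) /=; try by lia.
rewrite big_mkcond (@big_cat_nat _ _ _ x 0 n) /=; try by lia.
rewrite [X in _ + X]big_ltn // eqxx add0r addrC; congr (_ + _).
  rewrite -[x.+1]/(1 + x)%N big_addn big_nat [RHS]big_nat.
  apply: eq_bigr => i hi; rewrite ifT; last by lia.
  by congr F; rewrite (_ : _ - _ = i + n)%N; [rewrite modnDr modn_small //; lia|lia].
rewrite -[X in \sum_(X <= i < n) _](add0n (n - x)%N) big_addn (_ : n - (n - x) = x)%N; last by lia.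
rewrite big_nat [RHS]big_nat; apply: eq_bigr => i hi; rewrite ifT; last by lia.
by congr F; rewrite modn_small; lia.
Qed.

Lemma rot_loc_range n x y : (x < n)%N -> (y < n)%N -> y != x ->
  (0 < (y + n - x) %% n < n)%N.
Proof.
move=> hx hy ne; rewrite ltn_mod; have [le|lt] := leqP x y; last by rewrite modn_small; lia.
by rewrite -addnBAC // modnDr modn_small; lia.
Qed.

Lemma split_loopE e l x y : (x < size l)%N -> (y < size l)%N -> y != x ->
  let f := nth e l x in let r := drop x.+1 l ++ take x l in
  let s := split0 f r ((y + size l - x) %% size l).-1 in
  split_loop l x y = (core s.1, core s.2).
Proof.
move=> hx hy ne /=; rewrite /split_loop (rot_nth e) // /split0.
have /andP[y0 _] := rot_loc_range hx hy ne.
by rewrite prednK //; case: ifP.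
Qed.

Lemma basis_neq0 (i : 'I_d) : Defs.basis i != 0.
Proof. by apply/eqP => /ffunP/(_ i); rewrite !ffunE eqxx. Qed.

Lemma plaq_uniq1 v (a b : 'I_d) : a != b -> uniq [seq g.1 | g <- plaq v a b].
Proof.
move=> ne; have ne' : b != a by rewrite eq_sym.
rewrite /= !inE !xpair_eqE (negbTE ne) (negbTE ne') !andbF !eqxx !andbT /= !orbF.
by rewrite -subr_eq0 opprD addNKr oppr_eq0 basis_neq0 -subr_eq0 addrC addKr basis_neq0.
Qed.

(** The four edges stay distinct when orientation is forgotten, which excludes repetitions as well
    as the presence of both orientations. *)
Lemma plaq_single v (a b : 'I_d) e : a != b ->
  uniq (plaq v a b) /\ ~~ ((e \in plaq v a b) && (einv e \in plaq v a b)).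
Proof.
move=> /(plaq_uniq1 v) u1; split; first exact: map_uniq u1.
apply/negP => /andP[/(nthP e)[i hi ei] /(nthP e)[j hj ej]].
have : i == j.
  rewrite -(nth_uniq e.1 _ _ u1) ?size_map // !(nth_map e) // ei ej.
  by case: (e) => [[? ?] ?].
by move/eqP => ij; move: ej; rewrite -ij ei => /eqP; rewrite eq_sym einv_eqF.
Qed.

Lemma dir_pairsP (ab : 'I_d * 'I_d) : (ab \in dir_pairs d) = (ab.1 < ab.2)%N.
Proof.
rewrite mem_filter; case: ltnP => //= _; apply/allpairsP.
by exists ab; rewrite !mem_enum; split=> //; case: ab.
Qed.

Lemma dir_pairs_uniq : uniq (dir_pairs d).
Proof.
by apply/filter_uniq/allpairs_uniq; rewrite ?enum_uniq // => -[? ?] [? ?].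
Qed.

Definition corners p : seq (vtx d) := map (@esrc d) p.

Lemma PplusLP (L : seq (vtx d)) p : reflect (exists v (a b : 'I_d),
    [/\ (a < b)%N, p = plaq v a b & {subset corners p <= L}]) (p \in PplusL L).
Proof.
apply: (iffP mapP) => [[[v [a b]]]|[v [a [b [lt -> sub]]]]].
  rewrite mem_filter /= => /andP[/and3P[h1 h2 h3] /allpairsP[[v' ab'] /= [hv hab [ev eab]]]] ->.
  rewrite -ev mem_undup in hv; rewrite -eab dir_pairsP in hab.
  exists v, a, b; split=> // z; rewrite !inE => /or4P[] /eqP-> //=.
  by rewrite addrAC.
exists (v, (a, b)) => //; rewrite mem_filter /=.
have h z : z \in corners (plaq v a b) -> z \in L by apply: sub.
rewrite !h ?inE ?eqxx ?orbT //=; last by rewrite addrAC eqxx ?orbT.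
apply/allpairsP; exists (v, (a, b)); rewrite mem_undup dir_pairsP h //.
by rewrite !inE eqxx.
Qed.

(** The unoriented edges of a plaquette start at v, v + e_a or v + e_b, so every possible v is among
    the candidate base points. *)
Lemma PplusP e p : reflect (exists v (a b : 'I_d),
    [/\ (a < b)%N, p = plaq v a b & (e \in p) || (einv e \in p)]) (p \in Pplus e).
Proof.
case: e => [[x i] s]; rewrite /Pplus mem_undup mem_filter.
apply: (iffP andP) => [[he /allpairsP[[v ab] /= [_ hab pE]]]|[v [a [b [lt pE he]]]]].
  by exists v, ab.1, ab.2; split; rewrite -?dir_pairsP.
split=> //; apply/allpairsP; exists (v, (a, b)); rewrite dir_pairsP; split=> //.
have : (x, i) \in [seq g.1 | g <- p].
  by case/orP: he => h; apply/mapP; [exists (x, i, s)|exists (x, i, ~~ s)].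
have sub j : v + Defs.basis j = x ->
    v \in x :: [seq x - Defs.basis j | j <- enum 'I_d].
  move=> vx; rewrite inE; apply/orP; right; apply/mapP; exists j; rewrite ?mem_enum //.
  by rewrite -vx addrK.
rewrite pE !inE !xpair_eqE => /or4P[] /andP[/eqP h _]; try by move: (sub _ (esym h)); rewrite inE.
- by rewrite h eqxx.
- by rewrite h eqxx.
Qed.

Lemma Pplus_uniq e : uniq (Pplus e).
Proof. by case: e => [[x i] s]; rewrite /Pplus undup_uniq. Qed.

Lemma PplusL_uniq (L : seq (vtx d)) : uniq (PplusL L).
Proof.
rewrite map_inj_uniq; last by move=> [v [a b]] [v' [a' b']] /= [-> -> _ _ _ _ _ ->].
apply/filter_uniq/allpairs_uniq; rewrite ?undup_uniq ?dir_pairs_uniq //.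
by move=> [? ?] [? ?].
Qed.

(** In a large enough volume, the plaquettes of the Gibbs weight that feel the edge are the same as
    in the infinite lattice. *)
Lemma PplusL_filter e (L : seq (vtx d)) : (forall p, p \in Pplus e -> {subset corners p <= L}) ->
  perm_eq [seq p <- PplusL L | (e \in p) || (einv e \in p)] (Pplus e).
Proof.
move=> hL; apply: uniq_perm; first exact/filter_uniq/PplusL_uniq.
  exact: Pplus_uniq.
move=> p; rewrite mem_filter; apply/andP/idP => [[he /PplusLP[v [a [b [lt pE _]]]]]|hp].
  by apply/PplusP; exists v, a, b.
have /PplusP[v [a [b [lt pE he]]]] := hp.
by split=> //; apply/PplusLP; exists v, a, b; split=> //; apply: hL.
Qed.

Lemma Pplus_einv e : Pplus (einv e) =i Pplus e.
Proof.
move=> p; apply/PplusP/PplusP => -[v [a [b [lt pE he]]]]; exists v, a, b; split=> //; move: he.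
  by rewrite einvK orbC.
by rewrite einvK orbC.
Qed.

End Locations.

(** * Splittings and deformations produce loops *)

Section Closedness.
Variable d : nat.
Implicit Types (e f a : edge d) (l r p c dd : seq (edge d)).

Lemma walk_cons x f r y : walk x (f :: r) y <-> esrc f = x /\ walk (etgt f) r y.
Proof. by rewrite /=; split=> [/andP[/eqP]|[->]]; rewrite ?eqxx. Qed.

Lemma split0_closed f r j : closed_path (f :: r) -> (j < size r)%N ->
  (nth f r j == f) || (nth f r j == einv f) ->
  closed_path (split0 f r j).1 /\ closed_path (split0 f r j).2.
Proof.
move=> cl hj hn; rewrite /split0.
have : closed_path (f :: take j r ++ nth f r j :: drop j.+1 r).
  by rewrite -drop_nth // cat_take_drop.
case/closed_pathP=> z /walk_cons[ez /walk_cat[z' wb /walk_cons[ez' wc]]].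
case: eqP hn ez' wc => [-> _|_ /= /eqP->] ez' wc.
  split; apply/closed_pathP; first by exists z; apply/walk_cons.
  exists (etgt f); rewrite -cats1; apply/walk_cat; exists z' => //=.
  by rewrite ez' !eqxx.
rewrite esrc_einv etgt_einv in ez' wc.
by split; apply/closed_pathP; [exists z; rewrite -{1}ez|exists (etgt f); rewrite {2}ez'].
Qed.

(** Convergence to the limit functional is available on loops only, so every term of the equation
    has to be recognised as one. *)
Lemma split_loop_loop e l x y : is_loop l -> (x < size l)%N -> (y < size l)%N -> y != x ->
  (nth e l y == nth e l x) || (nth e l y == einv (nth e l x)) ->
  is_loop (split_loop l x y).1 /\ is_loop (split_loop l x y).2.
Proof.
case/andP=> cl _ hx hy ne hn; rewrite (split_loopE e) //.
set r := drop x.+1 l ++ take x l; set j := (_ %% _).-1.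
have sr : size (rot x l) = (size r).+1 by rewrite (rot_nth e).
have /andP[y0 lt] := rot_loc_range hx hy ne.
have hj : (j < size r)%N by rewrite -ltnS -sr size_rot /j; lia.
have nj : nth (nth e l x) r j = nth e l y.
  rewrite (set_nth_default e) // -(@nth_rot_loc _ e l x y) // (rot_nth e) //.
  by rewrite -/r -(prednK y0).
have cl' : closed_path (nth e l x :: r).
  by rewrite -rot_nth // /rot; apply: closed_path_catC; rewrite cat_take_drop.
rewrite -nj in hn; have [h1 h2] := split0_closed cl' hj hn.
by split; apply: core_loop.
Qed.

Lemma closed_plaq v (a b : 'I_d) : closed_path (plaq v a b).
Proof.
apply/closed_pathP; exists v; rewrite /= !eqxx /= andbT.
by rewrite addrAC eqxx.
Qed.

Lemma deform_loop f r p (plus : bool) : closed_path (f :: r) -> closed_path p ->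
  (f \in p) || (einv f \in p) -> is_loop (deform plus (f :: r) 0 p).
Proof.
case/closed_pathP=> z /walk_cons[ez wr] /closed_pathP[y wp] hp.
have splitp a : a \in p ->
    walk y (take (index a p) p) (esrc a) /\ walk (etgt a) (drop (index a p).+1 p) y.
  move=> ha; move: wp; rewrite -{1}(cat_take_drop (index a p) p).
  by rewrite (drop_nth a) ?index_mem // nth_index // => /walk_cat[z' w1 /walk_cons[-> w2]].
rewrite -ez in wr; rewrite /deform rot0.
case: ifP hp => [fp _|_ /= fp]; have [wc wd] := splitp _ fp.
  case: plus; apply: core_loop; apply/closed_pathP; exists (esrc f).
    apply/walk_cons; split=> //; apply/walk_cat; exists y => //.
    by apply/walk_cat; exists (esrc f) => //; apply/walk_cons.
  apply/walk_cat; exists y; first exact: walk_pinv.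
  by apply/walk_cat; exists (etgt f) => //; apply: walk_pinv.
rewrite esrc_einv etgt_einv in wc wd.
case: plus; apply: core_loop; apply/closed_pathP; exists (esrc f).
  apply/walk_cons; split=> //; apply/walk_cat; exists y; first exact: walk_pinv.
  apply/walk_cat; exists (esrc f); first exact: walk_pinv.
  exact/walk_cons.
apply/walk_cat; exists y => //.
by apply/walk_cat; exists (etgt f).
Qed.

Lemma deform_rot plus l x p : deform plus l x p = deform plus (rot x l) 0 p.
Proof. by rewrite /deform rot0. Qed.

End Closedness.

(** * The loop equation at finite N *)

Section LocationIdentity.
Variables (R : realType) (N d : nat) (Q : config R d N).
Hypothesis hQ : SOconf Q.
Implicit Types (e f : edge d) (l : seq (edge d)).
Local Notation W := (wilson Q).

Definition locword e l x := pword e (nth e l x) (drop x.+1 l ++ take x l).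

Lemma size_locword e l x : (x < size l)%N -> size (locword e l x) = size l.
Proof.
move=> hx; rewrite size_pword -(size_rot x l) (rot_nth e) //.
Qed.

Lemma split_location e l x : (x < size l)%N ->
  (nth e l x == e) || (nth e l x == einv e) ->
  let w := locword e l x in
  esign R e (nth e l x) * \sum_(k < size w) esign R e (nth e w k) *
    (W (take (inspos e w k) w) * W (drop (inspos e w k) w)) =
  N%:R * W l + \sum_(0 <= y < size l | y != x) esign R (nth e l x) (nth e l y) *
    (W (split_loop l x y).1 * W (split_loop l x y).2).
Proof.
move=> hx hf /=; rewrite /locword; set f := nth e l x; set r := drop x.+1 l ++ take x l.
have rE : rot x l = f :: r by rewrite (rot_nth e).
have sr : size l = (size r).+1 by rewrite -(size_rot x l) rE.
rewrite sum_split_pword // -rE wilson_rot //; congr (_ + _).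
pose F k := esign R f (nth f r k.-1) * (W (split0 f r k.-1).1 * W (split0 f r k.-1).2).
rewrite (_ : size r = (size l).-1); last by rewrite sr.
rewrite -(sum_rot_loc F hx) [LHS]big_nat_cond [RHS]big_nat_cond.
apply: eq_bigr => y /andP[/andP[_ hy] ne].
rewrite (split_loopE e) // -/f -/r /F !wilson_core //; congr (esign R f _ * _).
have /andP[y0 lt] := rot_loc_range hx hy ne.
rewrite -(nth_rot_loc e hx hy) rE -(prednK y0) /=.
by apply: set_nth_default; rewrite -ltnS -sr; lia.
Qed.

Lemma deform_location e (L : seq (vtx d)) l x : (x < size l)%N ->
  (nth e l x == e) || (nth e l x == einv e) ->
  (forall p, p \in Pplus e -> {subset corners p <= L}) ->
  let w := locword e l x in
  esign R e (nth e l x) * (\sum_(p <- PplusL L) \sum_(k < size p) esign R e (nth e p k) *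
    (W (w ++ Defs.pinv (rot (inspos e p k) p)) - W (w ++ rot (inspos e p k) p))) =
  \sum_(p <- Pplus e) (W (deform false l x p) - W (deform true l x p)).
Proof.
move=> hx hf hL /=; rewrite mulr_sumr (bigID (fun p => (e \in p) || (einv e \in p))) /=.
rewrite [X in _ + X]big1 ?addr0; last first.
  move=> p; rewrite negb_or => /andP[h1 h2]; rewrite big1 ?mulr0 // => k _.
  rewrite esign0 ?mul0r //.
    by apply: contra h1 => /eqP <-; apply: mem_nth.
  by apply: contra h2 => /eqP <-; apply: mem_nth.
rewrite -big_filter (perm_big _ (PplusL_filter hL)) /= !big_seq.
apply: eq_bigr => p /PplusP[v [a [b [lt pE he]]]].
have ab : a != b by apply: contraTneq lt => ->; rewrite ltnn.
have [u1 u2] := plaq_single v e ab; rewrite -pE in u1 u2.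
by rewrite /locword deform_pword // -rot_nth // -!deform_rot.
Qed.


Lemma esign_bound e f : `|esign R e f| <= 1.
Proof. by rewrite /esign; case: ifP => _; [|case: ifP => _]; rewrite ?normrN ?normr1 ?normr0. Qed.

Lemma prod_wilson_bound (s : seq (seq (edge d))) :
  `|\prod_(l <- s) W l| <= N%:R ^+ size s.
Proof.
elim: s => [|l s IH]; first by rewrite big_nil normr1.
by rewrite big_cons normrM exprS ler_pM ?wilson_bound.
Qed.

(** Each letter of [v] yields a difference of two single traces with prefactor 2: the merged terms
    are of order N, where two separate traces would give N^2. *)
Lemma sum_skew_pair_bound (pe : posedge d) (w v : seq (edge d)) :
  `|\sum_a \sum_b \tr (rotgen R a b *m wmat Q w) * \tr (dwmat pe (rotgen R a b) Q v)|
    <= 4 * (size v)%:R * N%:R.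
Proof.
rewrite sum_skew_dwmat_pair normrM ger0_norm // (_ : 4 = 2 * 2); last by rewrite -natrM.
rewrite -!mulrA ler_wpM2l //; apply: (le_trans (ler_norm_sum _ _ _)).
rewrite mulrCA mulr_natl -[X in _ *+ X]card_ord -sumr_const; apply: ler_sum => k _.
rewrite normrM -[leRHS]mul1r ler_pM ?esign_bound //.
apply: (le_trans (ler_normB _ _)); rewrite tr_wmat_trmx (_ : 2 = 1 + 1 :> R) // mulrDl mul1r.
by rewrite lerD ?wilson_bound.
Qed.

Definition skew_dprod (pe : posedge d) (w : seq (edge d)) (s : seq (seq (edge d))) : R :=
  \sum_a \sum_b \tr (rotgen R a b *m wmat Q w) * dprod pe (rotgen R a b) Q s.

(** Merging [w] into one of the loops of [s] uses up a trace, so [size s] traces remain out of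
    [size s] + 1. *)
Lemma skew_dprod_bound pe w s :
  `|skew_dprod pe w s| <= 4 * (\sum_(l <- s) (size l)%:R) * N%:R ^+ size s.
Proof.
rewrite /skew_dprod; elim: s => [|l s IH] /=.
  rewrite big_nil mulr0 mul0r big1 ?normr0 // => a _.
  by rewrite big1 // => b _; rewrite mulr0.
pose T a b := \tr (rotgen R a b *m wmat Q w).
have -> : \sum_a \sum_b T a b * (\tr (dwmat pe (rotgen R a b) Q l) * \prod_(l <- s) W l
      + W l * dprod pe (rotgen R a b) Q s) =
    (\sum_a \sum_b T a b * \tr (dwmat pe (rotgen R a b) Q l)) * \prod_(l <- s) W l
    + W l * \sum_a \sum_b T a b * dprod pe (rotgen R a b) Q s.
  rewrite mulr_suml mulr_sumr -big_split; apply: eq_bigr => a _.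
  rewrite mulr_suml mulr_sumr -big_split; apply: eq_bigr => b _ /=.
  by ring.
apply: (le_trans (ler_normD _ _)); rewrite big_cons !normrM mulrDr mulrDl; apply: lerD.
  by rewrite exprS mulrA ler_pM ?sum_skew_pair_bound ?prod_wilson_bound.
rewrite exprS mulrCA ler_pM ?wilson_bound //.
Qed.

End LocationIdentity.

(** * Gibbs expectations and integration by parts *)

Section Expectation.
Variables (R : realType) (N d : nat) (I : ('M[R]_N -> R) -> R).
Hypothesis hI : is_haar_integral I.
Variables (L : seq (vtx d)) (beta : R).
Implicit Types (F G : config R d N -> R).
Local Notation E := (lgt_expect I L beta).
Let wt : config R d N -> R := gibbs_weight L beta.

Lemma loclip_weighted F : loclip F -> loclip (fun Q => F Q * wt Q).
Proof. by move=> h; apply: loclip_mul => //; apply: loclip_gibbs. Qed.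

Lemma partition_gt0 : 0 < prod_int I (Eplus L) wt (@config0 R d N).
Proof.
have lg : loclip (fun Q : config R d N => N%:R * beta * \sum_(p <- PplusL L) wilson Q p).
  apply: loclip_mul; first exact: loclip_cst.
  by apply: loclip_sum => p; apply: loclip_wilson.
have [K K0 hK] := loclip_SO lg.
apply: (@lt_le_trans _ _ (expR (- K))); first exact: expR_gt0.
rewrite -(prod_int_cst hI (Eplus L) (expR (- K)) (@config0 R d N)).
apply: prod_int_le => //; try exact: loclip_cst; try exact: loclip_gibbs.
  exact: SOconf_config0.
move=> Q /hK; rewrite ler_norml => /andP[h _].
by rewrite /wt /gibbs_weight ler_expR.
Qed.

Let b0 := SOconf_bounded (@SOconf_config0 R N d).

Lemma expectD F G : loclip F -> loclip G -> E (fun Q => F Q + G Q) = E F + E G.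
Proof.
move=> hF hG; rewrite /lgt_expect -mulrDl -prod_intD //; try exact: loclip_weighted.
by congr (_ / _); congr prod_int; apply/funext => Q; rewrite mulrDl.
Qed.

Lemma expectZ (c : R) F : loclip F -> E (fun Q => c * F Q) = c * E F.
Proof.
move=> hF; rewrite /lgt_expect mulrA -prod_intZ //; last exact: loclip_weighted.
by congr (_ / _); congr prod_int; apply/funext => Q; rewrite mulrA.
Qed.

Lemma expect_le F G : loclip F -> loclip G ->
  (forall Q, SOconf Q -> F Q <= G Q) -> E F <= E G.
Proof.
move=> hF hG h; rewrite /lgt_expect ler_pM2r ?invr_gt0 ?partition_gt0 //.
apply: prod_int_le => //; try exact: loclip_weighted; first exact: SOconf_config0.
by move=> Q hQ; rewrite ler_wpM2r ?expR_ge0 // h.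
Qed.

Lemma expect_cst (c : R) : E (fun=> c) = c.
Proof.
rewrite /lgt_expect prod_intZ //; last exact: loclip_gibbs.
by rewrite mulfK // gt_eqF // partition_gt0.
Qed.

Lemma expect_norm F (K : R) : loclip F ->
  (forall Q, SOconf Q -> `|F Q| <= K) -> `|E F| <= K.
Proof.
move=> hF h; rewrite ler_norml -{1}(expect_cst (- K)) -{2}(expect_cst K).
by apply/andP; split; apply: expect_le => //; try exact: loclip_cst;
  move=> Q /h; rewrite ler_norml => /andP[].
Qed.

Lemma expect_sum (J : Type) (r : seq J) (P : pred J) (F : J -> config R d N -> R) :
  (forall i, loclip (F i)) ->
  E (fun Q => \sum_(i <- r | P i) F i Q) = \sum_(i <- r | P i) E (F i).
Proof.
move=> hF; elim: r => [|i r IH].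
  rewrite big_nil -[RHS]expect_cst; congr E; apply/funext => Q; exact: big_nil.
rewrite big_cons -IH; case Pi : (P i).
  rewrite -expectD //; last exact: loclip_sum.
  by congr E; apply/funext => Q; rewrite big_cons Pi.
by congr E; apply/funext => Q; rewrite big_cons Pi.
Qed.

(** The derivative of Tr(X Q_w) times the Wilson loops times the weight, with the weight divided
    out; the three summands differentiate the three factors in turn. *)
Definition sd_integrand (pe : posedge d) (w : seq (edge d)) (s : seq (seq (edge d))) a b : config R d N -> R := fun Q =>
  \tr (rotgen R a b *m dwmat pe (rotgen R a b) Q w) * \prod_(l <- s) wilson Q l
  + \tr (rotgen R a b *m wmat Q w) * dprod pe (rotgen R a b) Q s
  + \tr (rotgen R a b *m wmat Q w) * \prod_(l <- s) wilson Q l *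
    (N%:R * beta * \sum_(p <- PplusL L) \tr (dwmat pe (rotgen R a b) Q p)).

Lemma sd_integrandP pe w s a b :
  loclip (sd_integrand pe w s a b) /\ (pe \in Eplus L -> E (sd_integrand pe w s a b) = 0).
Proof.
have [rt hrt] := rotation_curve_rotgen R a b; set X := rotgen R a b in hrt *.
have d1 : ederiv pe rt (fun Q => \tr (X *m wmat Q w)) (fun Q => \tr (X *m dwmat pe X Q w)).
  apply: deriv_tr => i j.
  apply: eq_deriv (deriv_mulmx hrt (deriv_cstmx pe rt X) (deriv_wmat pe hrt w) i j) => Q //.
  by rewrite mul0mx add0r.
have d2 := deriv_mul hrt d1 (deriv_prod pe hrt s).
have [_ l1 _] := d2.
have d3 := deriv_mul hrt d2 (deriv_gibbs pe hrt L beta).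
have [_ lW _] := deriv_sum (PplusL L) (deriv_wilson pe hrt).
split=> [|hpe].
  apply: loclip_add; first exact: l1.
  case: d2 => l2 _ _; apply: loclip_mul => //.
  by apply: loclip_mul => //; apply: loclip_cst.
rewrite /lgt_expect -[RHS](mul0r (prod_int I (Eplus L) wt (@config0 R d N))^-1).
congr (_ / _); rewrite -[RHS](prod_int_deriv hrt hI hpe (@SOconf_config0 R N d) d3).
congr prod_int; apply/funext => Q; rewrite /sd_integrand /=.
by rewrite mulrDl; congr (_ + _); rewrite -!mulrA.
Qed.

End Expectation.

(** * The loop equation up to an error of order 1/N *)

Section FiniteN.
Variables (R : realType) (N d : nat) (I : ('M[R]_N -> R) -> R).
Hypothesis hI : is_haar_integral I.
Hypothesis N0 : (0 < N)%N.
Variables (L : seq (vtx d)) (beta : R) (pe : posedge d).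
Hypothesis hpe : pe \in Eplus L.
Let e : edge d := (pe, true).
Hypothesis hL : forall p, p \in Pplus e -> {subset corners p <= L}.
Variables (l : seq (edge d)) (s : seq (seq (edge d))) (x : nat).
Hypothesis hx : (x < size l)%N.
Let f := nth e l x.
Hypothesis hf : (f == e) || (f == einv e).
Local Notation E := (lgt_expect I L beta).
Local Notation Pr s := (fun Q : config R d N => \prod_(l <- s) wilson Q l).

(** Left side minus right side of the limiting equation at the single location [x]; [esign] records
    whether the two locations carry equal or opposite edges. *)
Definition loop_defect (phi : seq (seq (edge d)) -> R) : R :=
  phi (l :: s)
  + \sum_(0 <= y < size l | y != x) esign R f (nth e l y) *
      phi ((split_loop l x y).1 :: (split_loop l x y).2 :: s)
  - beta * \sum_(p <- Pplus e) (phi (deform false l x p :: s) - phi (deform true l x p :: s)).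

(** The defect before normalisation. Splitting creates one more trace than the other terms have, so
    these receive an extra factor N. *)
Definition scaled_defect (Q : config R d N) : R :=
  N%:R * Pr (l :: s) Q
  + (\sum_(0 <= y < size l | y != x) esign R f (nth e l y) *
      Pr ((split_loop l x y).1 :: (split_loop l x y).2 :: s) Q
  + - (N%:R * beta) * \sum_(p <- Pplus e)
      (Pr (deform false l x p :: s) Q + -1 * Pr (deform true l x p :: s) Q)).

Lemma loclip_Pr s' : loclip (Pr s').
Proof. by apply: loclip_prod => l'; apply: loclip_wilson. Qed.

Lemma expect_scaled_defect :
  loclip scaled_defect /\
  E scaled_defect = N%:R ^+ (size s).+2 * loop_defect (phiL I L beta).
Proof.
have lP := loclip_Pr.
have lZ c s' : loclip (fun Q => c * Pr s' Q) by apply: loclip_mul => //; apply: loclip_cst.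
have lS : loclip (fun Q => \sum_(0 <= y < size l | y != x) esign R f (nth e l y) *
      Pr ((split_loop l x y).1 :: (split_loop l x y).2 :: s) Q).
  by apply: loclip_sum => y; apply: lZ.
have lD' p : loclip (fun Q => Pr (deform false l x p :: s) Q + -1 * Pr (deform true l x p :: s) Q).
  by apply: loclip_add => //; apply: lZ.
have lD : loclip (fun Q => \sum_(p <- Pplus e)
      (Pr (deform false l x p :: s) Q + -1 * Pr (deform true l x p :: s) Q)).
  by apply: loclip_sum => p; apply: lD'.
have lD2 : loclip (fun Q => - (N%:R * beta) * \sum_(p <- Pplus e)
      (Pr (deform false l x p :: s) Q + -1 * Pr (deform true l x p :: s) Q)).
  by apply: loclip_mul => //; apply: loclip_cst.
split; first by apply: loclip_add; [exact: lZ|exact: loclip_add].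
rewrite /scaled_defect expectD //; last exact: loclip_add.
rewrite expectZ // expectD // expectZ // !expect_sum //.
have n0 : N%:R != 0 :> R by rewrite pnatr_eq0 -lt0n.
have phE s' : E (Pr s') = N%:R ^+ size s' * phiL I L beta s'.
  by rewrite /phiL mulrCA mulfV ?mulr1 // expf_neq0.
rewrite /loop_defect mulrBr mulrDr phE /= exprS -addrA; congr (_ + (_ + _)).
- by rewrite !exprS; ring.
- rewrite mulr_sumr; apply: eq_bigr => y _.
  by rewrite expectZ // phE /= !exprS; ring.
- rewrite mulNr; congr (- _).
  rewrite (exprS _ (size s).+1) -[LHS]mulrA -[RHS]mulrA; congr (_ * _).
  rewrite [RHS]mulrCA; congr (_ * _); rewrite mulr_sumr; apply: eq_bigr => p _.
  by rewrite expectD // expectZ // !phE /= mulrBr mulN1r.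
Qed.

Let w := locword e l x.

Definition sd_total (Q : config R d N) : R := \sum_a \sum_b sd_integrand L beta pe w s a b Q.

Lemma expect_sd_total : loclip sd_total /\ E sd_total = 0.
Proof.
have h a b := (sd_integrandP hI L beta pe w s a b).
have h1 a : loclip (fun Q : config R d N => \sum_b sd_integrand L beta pe w s a b Q).
  by apply: loclip_sum => b; apply h.
split; first exact: loclip_sum.
rewrite /sd_total expect_sum // big1 // => a _; rewrite expect_sum //.
  by rewrite big1 // => b _; apply h.
by move=> b; apply h.
Qed.

(** Adding a multiple of [sd_total], whose expectation is zero, cancels the splittings and
    deformations. What remains are the terms in which a piece is reversed or two loops merge. *)
Lemma scaled_defect_sd (Q : config R d N) : SOconf Q ->
  scaled_defect Q + esign R e f / 2 * sd_total Q =
  esign R e f * (\sum_(k < size w) esign R e (nth e w k) *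
    wilson Q (take (inspos e w k) w ++ Defs.pinv (drop (inspos e w k) w))) * Pr s Q
  + esign R e f / 2 * skew_dprod Q pe w s.
Proof.
move=> hQ; set eps := esign R e f.
set A := \sum_(k < size w) _.
pose B := \sum_(k < size w) esign R e (nth e w k) *
  (wilson Q (take (inspos e w k) w) * wilson Q (drop (inspos e w k) w)).
pose C := \sum_(p <- PplusL L) \sum_(k < size p) esign R e (nth e p k) *
  (wilson Q (w ++ Defs.pinv (rot (inspos e p k) p)) - wilson Q (w ++ rot (inspos e p k) p)).
have hB : eps * B = N%:R * wilson Q l + \sum_(0 <= y < size l | y != x)
    esign R f (nth e l y) * (wilson Q (split_loop l x y).1 * wilson Q (split_loop l x y).2).
  exact: split_location.
have hC : eps * C = \sum_(p <- Pplus e)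
    (wilson Q (deform false l x p) - wilson Q (deform true l x p)).
  exact: deform_location.
have -> : scaled_defect Q = (eps * B - N%:R * beta * (eps * C)) * Pr s Q.
  rewrite hB hC /scaled_defect mulrBl mulrDl -addrA; congr (_ + (_ + _)).
  - by rewrite big_cons mulrA.
  - by rewrite mulr_suml; apply: eq_bigr => y _; rewrite !big_cons !mulrA.
  - rewrite mulNr -(mulrA (N%:R * beta)); congr (- (_ * _)).
    by rewrite mulr_suml; apply: eq_bigr => p _; rewrite !big_cons; ring.
have -> : sd_total Q = 2 * (A - B) * Pr s Q + skew_dprod Q pe w s
    + N%:R * beta * (2 * C) * Pr s Q.
  rewrite /sd_total /sd_integrand /=.
  under eq_bigr => a _ do rewrite 2!big_split /=.
  rewrite 2!big_split /=; congr (_ + _ + _).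
    under eq_bigr => a _ do rewrite -mulr_suml.
    rewrite -mulr_suml sum_skew_dwmat; congr (_ * _ * _).
    rewrite /A /B -sumrB; apply: eq_bigr => k _.
    by rewrite mulrBr tr_wmat_trmx.
  have -> : N%:R * beta * (2 * C) * Pr s Q =
      \sum_(p <- PplusL L) \sum_a \sum_b N%:R * beta * Pr s Q *
      (\tr (rotgen R a b *m wmat Q w) * \tr (dwmat pe (rotgen R a b) Q p)).
    rewrite /C 2!mulr_sumr mulr_suml; apply: eq_bigr => p _.
    under [RHS]eq_bigr => a _ do rewrite -mulr_sumr.
    rewrite -mulr_sumr sum_skew_dwmat_pair mulrAC; congr (_ * (_ * _)).
    by apply: eq_bigr => k _; rewrite tr_wmat_trmx.
  rewrite [RHS]exchange_big; apply: eq_bigr => a _.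
  rewrite [RHS]exchange_big; apply: eq_bigr => b _ /=.
  by rewrite !mulr_sumr; apply: eq_bigr => p _; ring.
by field.
Qed.

(** The remaining terms are at most a constant times N^(size s + 1), whereas the defect was scaled
    by N^(size s + 2). *)
Lemma loop_defect_bound :
  `|loop_defect (phiL I L beta)| <=
    ((size l)%:R + 2 * \sum_(l' <- s) (size l')%:R) / N%:R.
Proof.
have [lF eF] := expect_scaled_defect; have [lT eT] := expect_sd_total.
set K : R := _ + _; have n0 : 0 < N%:R :> R by rewrite ltr0n.
have lG : loclip (fun Q => esign R e f / 2 * sd_total Q).
  by apply: loclip_mul => //; apply: loclip_cst.
have : `|E (fun Q => scaled_defect Q + esign R e f / 2 * sd_total Q)| <= K * N%:R ^+ (size s).+1.
  apply: expect_norm => //; first exact: loclip_add.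
  move=> Q hQ; rewrite scaled_defect_sd //.
  apply: (le_trans (ler_normD _ _)); rewrite mulrDl; apply: lerD.
    rewrite exprS mulrA normrM ler_pM ?prod_wilson_bound // normrM -[leRHS]mul1r.
    rewrite ler_pM ?esign_bound //; apply: (le_trans (ler_norm_sum _ _ _)).
    rewrite -(size_locword e hx) mulr_natl -[X in _ *+ X]card_ord -sumr_const.
    apply: ler_sum => k _; rewrite normrM -[leRHS]mul1r.
    by rewrite ler_pM ?esign_bound ?wilson_bound.
  rewrite normrM.
  apply: (@le_trans _ _ (2^-1 * (4 * (\sum_(l' <- s) (size l')%:R) * N%:R ^+ size s))).
    rewrite ler_pM ?skew_dprod_bound // normrM (ger0_norm (_ : 0 <= 2^-1)) ?invr_ge0 //.
    by rewrite -[leRHS]mul1r ler_wpM2r ?esign_bound ?invr_ge0.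
  set S := \sum_(l' <- s) _; have S0 : 0 <= S by apply: sumr_ge0.
  rewrite (_ : _ * _ = 2 * S * N%:R ^+ size s); last by field.
  rewrite ler_wpM2l ?mulr_ge0 // exprS ler_peMl ?exprn_ge0 ?ler0n //.
  by rewrite ler1n.
rewrite expectD // expectZ // eT mulr0 addr0 eF normrM ger0_norm ?exprn_ge0 ?ler0n //.
move=> h; rewrite ler_pdivlMr // -(ler_pM2l (exprn_gt0 (size s).+1 n0)).
set D := `|_| in h *.
rewrite (_ : _ * (D * _) = N%:R ^+ (size s).+2 * D); first by rewrite [leRHS]mulrC.
by rewrite (exprS _ (size s).+1); move: (N%:R ^+ (size s).+1) => a; ring.
Qed.

End FiniteN.

(** * Limits of real sequences *)

Section InfiniteVolume.
Variables (R : realType) (d : nat).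

Lemma cvg_seq_sum (J : eqType) (r : seq J) (P : pred J) (u : J -> nat -> R) (a : J -> R) :
  (forall i, i \in r -> P i -> u i k @[k --> \oo] --> a i) ->
  \sum_(i <- r | P i) u i k @[k --> \oo] --> \sum_(i <- r | P i) a i.
Proof.
elim: r => [|i r IH] h.
  by rewrite big_nil; under eq_fun do rewrite big_nil; exact: cvg_cst.
rewrite big_cons; under eq_fun do rewrite big_cons.
have hr : \sum_(j <- r | P j) u j k @[k --> \oo] --> \sum_(j <- r | P j) a j.
  by apply: IH => j jr; apply: h; rewrite inE jr orbT.
case Pi : (P i) => //.
by apply: cvgD => //; apply: h => //; rewrite mem_head.
Qed.

Lemma cvg_eq0_bound (u : nat -> R) (v C : R) (K : nat) : u k @[k --> \oo] --> v ->
  (forall k, (K <= k)%N -> `|u k| <= C / k%:R) -> v = 0.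
Proof.
move=> cu h.
have ch c : c * harmonic k @[k --> \oo] --> (0 : R).
  rewrite -[X in _ --> X](mulr0 c); apply: cvgMl_tmp; exact: cvg_harmonic.
have cu0 : u k @[k --> \oo] --> 0.
  apply: (squeeze_cvgr _ (ch (- (2 * `|C|))) (ch (2 * `|C|))).
  (* [harmonic] has general term 1 / (k + 1), and 1 / k <= 2 / (k + 1) once k >= 1. *)
  exists (maxn 1 K) => // k /=; rewrite geq_max => /andP[k1 kK].
  have : `|u k| <= 2 * `|C| * k.+1%:R^-1.
    apply: (le_trans (h k kK)); apply: (le_trans (ler_norm _)).
    rewrite normrM normfV (ger0_norm (ler0n _ k)).
    rewrite [2 * _]mulrC -mulrA ler_wpM2l // ler_pdivlMr ?ltr0n // mulrC.
    by rewrite ler_pdivrMr ?ltr0n // -natrM ler_nat; lia.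
  by rewrite ler_norml mulNr.
rewrite -(cvg_lim (@Rhausdorff R) cu); exact: (cvg_lim (@Rhausdorff R) cu0).
Qed.

End InfiniteVolume.

(** * The limit *)

Section Limit.
Variables (R : realType) (d : nat).

Lemma exhaustion (Lam : nat -> seq (vtx d)) (vs : seq (vtx d)) :
  (forall N, {subset Lam N <= Lam N.+1}) -> (forall v, exists N, v \in Lam N) ->
  exists n, forall m, (n <= m)%N -> {subset vs <= Lam m}.
Proof.
move=> hinc hcov.
have mono n m : (n <= m)%N -> {subset Lam n <= Lam m}.
  by move=> /subnKC <-; elim: (m - n)%N => [|k IH] v hv; rewrite ?addn0 // addnS; apply/hinc/IH.
elim: vs => [|v vs [n hn]]; first by exists 0.
have [n' hv] := hcov v; exists (maxn n n') => m; rewrite geq_max => /andP[h h'] u.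
by rewrite inE => /orP[/eqP->|]; [apply: (mono n')|apply: hn].
Qed.

Lemma mem_Eplus (L : seq (vtx d)) (pe : posedge d) :
  pe.1 \in L -> pe.1 + Defs.basis pe.2 \in L -> pe \in Eplus L.
Proof.
case: pe => v i /= hv hv'; rewrite mem_filter hv' /=; apply/allpairsP.
by exists (v, i); rewrite mem_undup mem_enum.
Qed.

Lemma loop_defect_limit (H : forall N, ('M[R]_N -> R) -> R) (Lam : nat -> seq (vtx d))
  (beta : R) (sigma : nat -> nat) (phi : seq (seq (edge d)) -> R)
  (pe : posedge d) (l : seq (edge d)) (s : seq (seq (edge d))) (x : nat) :
  (forall N, is_haar_integral (@H N)) ->
  (forall N, {subset Lam N <= Lam N.+1}) -> (forall v, exists N, v \in Lam N) ->
  (forall k, (sigma k < sigma k.+1)%N) ->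
  (forall s, all (@is_loop d) s ->
     phiL (@H (sigma k)) (Lam (sigma k)) beta s @[k --> \oo] --> phi s) ->
  all (@is_loop d) (l :: s) -> (x < size l)%N ->
  let e : edge d := (pe, true) in
  (nth e l x == e) || (nth e l x == einv e) ->
  loop_defect beta pe l s x phi = 0.
Proof.
move=> hH hinc hcov hsig hlim /andP[hl hs] hx e hf.
have sigk k : (k <= sigma k)%N by elim: k => // k IH; apply: leq_ltn_trans (hsig k).
(* All vertices the finite-volume bound refers to: the ends of the edge and the corners of the
   plaquettes through it. *)
pose vs := pe.1 :: pe.1 + Defs.basis pe.2 :: flatten (map (@corners d) (Pplus e)).
have [n hn] := exhaustion vs hinc hcov.
set C : R := (size l)%:R + 2 * \sum_(l' <- s) (size l')%:R.
have C0 : 0 <= C by rewrite addr_ge0 // mulr_ge0 // sumr_ge0.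
apply: (@cvg_eq0_bound R (fun k => loop_defect beta pe l s x
    (phiL (@H (sigma k)) (Lam (sigma k)) beta)) _ C (maxn n 1)); last first.
  move=> k; rewrite geq_max => /andP[nk k1].
  have k0 : (0 < sigma k)%N by apply: leq_trans k1 (sigk k).
  have sub : {subset vs <= Lam (sigma k)} by apply: hn; apply: leq_trans nk (sigk k).
  apply: (@le_trans _ _ (C / (sigma k)%:R)).
    apply: loop_defect_bound => //.
      by apply: mem_Eplus; apply: sub; rewrite !inE eqxx ?orbT.
    move=> p hp v hv; apply: sub; rewrite !inE; apply/orP; right; apply/orP; right.
    by apply/flattenP; exists (corners p) => //; apply: map_f.
  by rewrite ler_wpM2l // lef_pV2 ?posrE ?ltr0n // ler_nat.
rewrite /loop_defect; apply: cvgB; first apply: cvgD.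
- by apply: hlim; rewrite /= hl.
- apply: cvg_seq_sum => y; rewrite mem_index_iota => /andP[_ hy] ne.
  set f := nth _ l x; set g := nth _ l y.
  (* For an unrelated letter the formal splitting need not be a loop, so nothing is known about its
     limit; its coefficient is zero. *)
  case: (boolP ((g == f) || (g == einv f))) => [hg|]; last first.
    rewrite negb_or => /andP[h1 h2]; rewrite esign0 // mul0r.
    by under eq_fun do rewrite mul0r; exact: cvg_cst.
  apply: cvgMl_tmp; apply: hlim => /=.
  by have [-> ->] := split_loop_loop hl hx hy ne hg.
- apply: cvgMl_tmp; apply: cvg_seq_sum => p /PplusP[v [a [b [lt pE hp]]]] _.
  have cl : closed_path (rot x l).
    by rewrite /rot; apply: closed_path_catC; rewrite cat_take_drop; case/andP: hl.
  have hd plus : is_loop (deform plus l x p).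
    rewrite deform_rot (rot_nth e hx); apply: deform_loop; first by rewrite -rot_nth.
      by rewrite pE closed_plaq.
    by case/orP: hf => /eqP -> //; rewrite einvK orbC.
  by apply: cvgB; apply: hlim; rewrite /= hd.
Qed.

Lemma sum_disjoint_filter (I : Type) (r : seq I) (P Q : pred I) (F : I -> R) :
  (forall i, P i -> ~~ Q i) ->
  \sum_(i <- [seq i <- r | P i || Q i]) F i =
  \sum_(i <- [seq i <- r | P i]) F i + \sum_(i <- [seq i <- r | Q i]) F i.
Proof.
move=> h; rewrite !big_filter (bigID P) /=; congr (_ + _); apply: eq_bigl => i.
  by rewrite andbC; case: (P i).
by case Pi : (P i) => /=; rewrite ?andbT // (negbTE (h _ Pi)).
Qed.

(** Sorts the signed sum by relative orientation. Only the first sum has to exclude x, since [g x]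
    is never its own inverse. *)
Lemma sum_esign (g : nat -> edge d) (f : edge d) (n x : nat) (G : nat -> R) : g x = f ->
  \sum_(0 <= y < n | y != x) esign R f (g y) * G y =
  \sum_(y <- [seq y <- iota 0 n | g y == f] | x != y) G y
  - \sum_(y <- [seq y <- iota 0 n | g y == einv f]) G y.
Proof.
move=> gx; rewrite /index_iota subn0 2!big_filter_cond /= big_mkcond.
rewrite [X in _ = X - _]big_mkcond [X in _ = _ - X]big_mkcond -sumrB.
apply: eq_bigr => y _; rewrite eq_sym.
have [<-|ne] := eqVneq x y; first by rewrite andbF gx eq_sym einv_eqF subr0.
rewrite andbT /esign; have [->|nf] := eqVneq (g y) f.
  by rewrite eq_sym einv_eqF mul1r subr0.
by case: ifP => _; rewrite ?mulN1r ?sub0r ?mul0r ?oppr0.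
Qed.

End Limit.

Theorem theorem9p1 (R : realType) (d : nat) (hd : (2 <= d)%N)
  (* Haar integrals sigma_N on SO(N), for every N *)
  (H : forall N : nat, ('M[R]_N -> R) -> R) (hH : forall N : nat, is_haar_integral (H N))
  (* Lambda_N finite subsets of Z^d increasing to Z^d *)
  (Lam : nat -> seq (vtx d))
  (hLinc : forall N : nat, {subset Lam N <= Lam N.+1})
  (hLcov : forall v : vtx d, exists N : nat, v \in Lam N)
  (beta : R)
  (* a subsequence of N's along which phi_{Lambda_N, N, beta}(s) converges to phi(s)
     for every loop sequence s *)
  (sigma : nat -> nat) (hsigma : forall k : nat, (sigma k < sigma k.+1)%N)
  (phi : seq (seq (edge d)) -> R)
  (hlim : forall s : seq (seq (edge d)), all (@is_loop d) s ->
     (fun k => phiL (H (sigma k)) (Lam (sigma k)) beta s) @ \oo --> phi s)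
  (* a non-null loop sequence in minimal representation (l1, l2, ..., ln) *)
  (l1 : seq (edge d)) (ls : seq (seq (edge d)))
  (hloops : all (@is_loop d) (l1 :: ls))
  (hmin : all (fun l => l != [::]) (l1 :: ls))
  (* e is the first edge of l1 *)
  (e : edge d) (he : ohead l1 = Some e) :
  let A1 := [seq x <- iota 0 (size l1) | nth e l1 x == e] in
  let B1 := [seq x <- iota 0 (size l1) | nth e l1 x == einv e] in
  let C1 := [seq x <- iota 0 (size l1) | (nth e l1 x == e) || (nth e l1 x == einv e)] in
  let m := size C1 in
  let spl x y := (split_loop l1 x y).1 :: (split_loop l1 x y).2 :: ls in
  (m%:R * phi (l1 :: ls) =
     (\sum_(x <- A1) \sum_(y <- B1) phi (spl x y)
      + \sum_(x <- B1) \sum_(y <- A1) phi (spl x y)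
      - \sum_(x <- A1) \sum_(y <- A1 | x != y) phi (spl x y)
      - \sum_(x <- B1) \sum_(y <- B1 | x != y) phi (spl x y))
   + (beta * \sum_(p <- Pplus e) \sum_(x <- C1) phi (deform false l1 x p :: ls)
      - beta * \sum_(p <- Pplus e) \sum_(x <- C1) phi (deform true l1 x p :: ls)))%R.
Proof.
move=> A1 B1 C1 m spl.
have [hl hs] := andP hloops.
(* Derivatives are taken in the positively oriented edge; [e] may be its reverse, which changes
   neither the set of locations nor that of plaquettes. *)
pose e' : edge d := (e.1, true).
have ee : (e == e') || (e == einv e').
  by rewrite /e'; case: (e) => [[v i] []] /=; rewrite eqxx ?orbT.
have C1E x : (x \in C1) = ((nth e l1 x == e) || (nth e l1 x == einv e)) && (x < size l1)%N.
  by rewrite mem_filter mem_iota.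
pose S x := \sum_(0 <= y < size l1 | y != x)
  esign R (nth e l1 x) (nth e l1 y) * phi (spl x y).
pose D x := \sum_(p <- Pplus e) (phi (deform false l1 x p :: ls) - phi (deform true l1 x p :: ls)).
have loc x : x \in C1 -> phi (l1 :: ls) = - S x + beta * D x.
  rewrite C1E => /andP[hf hx].
  have hf' : (nth e' l1 x == e') || (nth e' l1 x == einv e').
    rewrite (set_nth_default e) //; case/orP: ee hf => /eqP -> //.
    by rewrite einvK orbC.
  have := loop_defect_limit hH hLinc hLcov hsigma hlim hloops hx hf'.
  rewrite /loop_defect -/e' (set_nth_default e) //.
  have -> : \sum_(p <- Pplus e') (phi (deform false l1 x p :: ls) - phi (deform true l1 x p :: ls))
      = D x.
    apply: perm_big; apply: uniq_perm; rewrite ?Pplus_uniq // => p.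
    by case/orP: ee => /eqP ->; rewrite ?Pplus_einv.
  have -> : \sum_(0 <= y < size l1 | y != x) esign R (nth e l1 x) (nth e' l1 y) * phi (spl x y) = S x.
    rewrite big_nat_cond [RHS]big_nat_cond; apply: eq_bigr => y /andP[/andP[_ hy] _].
    by rewrite (set_nth_default e).
  by move=> h; apply/eqP; rewrite -subr_eq0 -h; apply/eqP; ring.
have eqs x : nth e l1 x == e -> ~~ (nth e l1 x == einv e).
  by move=> /eqP ->; rewrite eq_sym einv_eqF.
(* The left side of the equation at x does not depend on x, so summing over [C1] produces the factor
   m. *)
have -> : m%:R * phi (l1 :: ls) = \sum_(x <- C1) (- S x + beta * D x).
  rewrite -(eq_big_seq _ loc) big_const_seq count_predT iter_addr_0 mulr_natl //.
rewrite big_split /= -mulr_sumr; congr (_ + _); last first.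
  rewrite -mulrBr; congr (_ * _); rewrite exchange_big -sumrB; apply: eq_bigr => p _.
  by rewrite -sumrB.
rewrite sum_disjoint_filter // -/A1 -/B1.
(* At a location of [A1], equal orientation means [A1] and opposite orientation [B1]; the roles are
   exchanged below for x in [B1]. *)
have -> : \sum_(x <- A1) - S x = \sum_(x <- A1) \sum_(y <- B1) phi (spl x y)
    - \sum_(x <- A1) \sum_(y <- A1 | x != y) phi (spl x y).
  rewrite -sumrB; apply: eq_big_seq => x; rewrite mem_filter => /andP[/eqP xe _].
  by rewrite /S xe (sum_esign (g := nth e l1)) // opprB.
have -> : \sum_(x <- B1) - S x = \sum_(x <- B1) \sum_(y <- A1) phi (spl x y)
    - \sum_(x <- B1) \sum_(y <- B1 | x != y) phi (spl x y).
  rewrite -sumrB; apply: eq_big_seq => x; rewrite mem_filter => /andP[/eqP xe _].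
  by rewrite /S xe (sum_esign (g := nth e l1)) // einvK opprB.
by ring.
Qed.
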